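(* Let $\mathbb{F}$ be a finite field, let $d\ge2$ be an integer, and let $\Psi:\mathbb{F}[X]\to[0,\infty)$ be any function. Then $\nu_d(\mathcal{H}^{(d)}(\Psi))=1$ if and only if $$\sum_{Q\text{ monic}}\nu_d\big(\mathcal{H}_Q^{(d)}(\Psi)\big)=\infty.$$
   Context: $\mathbb{F}$ is a finite field with $q$ elements, $\mathbb{F}[X]$ its polynomial ring, $\mathbb{F}((X^{-1}))$ the field of formal Laurent series in $X^{-1}$. $\partial f$ denotes the degree of $f\in\mathbb{F}((X^{-1}))$ (with $\partial 0=-\infty$), and $|f|=q^{\partial f}$ (with $|0|=0$). $B(g,r)=\{f\in\mathbb{F}((X^{-1})):|f-g|<r\}$. $\mathbb{L}$ is the set of $f\in\mathbb{F}((X^{-1}))$ with $\partial f<0$. $\nu$ is the Haar measure on $\mathbb{F}((X^{-1}))$ with $\nu(\mathbb{L})=1$, and $\nu_d$ is the $d$-fold product measure on $\mathbb{F}((X^{-1}))^d$. For monic $Q\in\mathbb{F}[X]$, $$\mathcal{H}_Q^{(d)}(\Psi)=\mathbb{L}^d\cap\Big(\bigcup_{(P_1,\ldots,P_d)}\ \prod_{i=1}^dB\Big(\frac{P_i}{Q},\frac{\Psi(Q)}{|Q|}\Big)\Big),$$ where the union is over all $(P_1,\ldots,P_d)\in\mathbb{F}[X]^d$ with $\partial P_i<\partial Q$ for each $i$ and $\gcd(P_1,P_2,\ldots,P_d,Q)=1$. Finally, $$\mathcal{H}^{(d)}(\Psi)=\bigcap_{n=1}^{\infty}\ \bigcup_{Q\text{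 monic},\ \partial Q\ge n}\mathcal{H}_Q^{(d)}(\Psi).$$ *)

(* Defs.v *)
From HB Require Import structures.
From mathcomp Require Import all_boot all_order all_algebra.
From mathcomp Require Import all_classical all_reals all_analysis.
From mathcomp Require Import zify.

Set Implicit Arguments.
Unset Strict Implicit.
Unset Printing Implicit Defensive.
Import Order.TTheory GRing.Theory Num.Theory.

Local Open Scope classical_set_scope.
Local Open Scope ring_scope.

Section LaurentZmodule.
Variable F : fieldType.

(* [f n] is the coefficient of X^n; only finitely many positive powers of X
   occur, so this is F((X^-1)) and not F((X)). *)
Definition bounded_above : {pred int -> F} :=
  [pred f | `[< exists N : int, forall n : int, N < n -> f n = 0 >]].

Record laurent := Laurent { lcoef :> int -> F ; _ : lcoef \in bounded_above }.

HB.instance Definition _ := [isSub for lcoef].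
HB.instance Definition _ := [Choice of laurent by <:].

Lemma bounded_aboveP (f : int -> F) :
  reflect (exists N : int, forall n, N < n -> f n = 0) (f \in bounded_above).
Proof. exact: asboolP. Qed.

Lemma laurentP (f g : laurent) : (f : int -> F) = g -> f = g.
Proof. exact: val_inj. Qed.

Lemma bounded_above_zmod : zmod_closed bounded_above.
Proof.
split=> [|f g /bounded_aboveP[N fN] /bounded_aboveP[M gM]].
  by apply/bounded_aboveP; exists 0.
apply/bounded_aboveP; exists (Num.max N M) => n; rewrite gt_max => /andP[Nn Mn].
by rewrite !fctE fN ?gM ?subr0.
Qed.

HB.instance Definition _ := GRing.isZmodClosed.Build _ bounded_above
  bounded_above_zmod.
HB.instance Definition _ := [SubChoice_isSubZmodule of laurent by <:].

Lemma laurentD (f g : laurent) n : (f + g) n = f n + g n.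
Proof. by []. Qed.

Lemma laurentN (f : laurent) n : (- f) n = - f n.
Proof. by []. Qed.

Lemma laurent0 n : (0 : laurent) n = 0.
Proof. by []. Qed.

End LaurentZmodule.

Section LaurentField.
Variable F : fieldType.
Implicit Types f g h : laurent F.

Definition bnd (f : int -> F) (N : int) := forall n, N < n -> f n = 0.

Lemma bnd_ex f : exists N, bnd f N.
Proof. by case: f => f fP; exact/bounded_aboveP. Qed.

Lemma bnd_le (f : int -> F) (N M : int) : bnd f N -> N <= M -> bnd f M.
Proof. by move=> fN NM n Mn; apply: fN; exact: le_lt_trans Mn. Qed.

(* The sum is finitely supported since f and g are bounded above. *)
Definition conv (f g : int -> F) (n : int) : F :=
  \sum_(i \in [set: int]) f i * g (n - i).

(* The first K coefficients of X^-N f, as a polynomial in X^-1. *)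
Definition ltrunc (f : int -> F) (N : int) (K : nat) : {poly F} :=
  \poly_(i < K) f (N - i%:Z).

Lemma convE (f g : int -> F) (N M : int) (k K : nat) : bnd f N -> bnd g M ->
  (k < K)%N -> conv f g (N + M - k%:Z) = (ltrunc f N K * ltrunc g M K)`_k.
Proof.
move=> fN gM kK; rewrite /conv.
rewrite (fsbigE [seq N - i%:Z | i <- iota 0 k.+1]) //; last first.
- move=> i _ iP.
  have [Ni|iN] := ltP N i; first by rewrite fN ?mul0r.
  have [ik|ki] := ltP (N + M - k%:Z - i) (M + 1); last first.
    by rewrite gM ?mulr0//; lia.
  exfalso; move: iP; apply/negP; rewrite negbK; apply/mapP; exists `|N - i|%N; last by lia.
  by rewrite mem_iota; lia.
- by rewrite map_inj_uniq ?iota_uniq// => i j; lia.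
rewrite big_map coefM (eq_bigl predT); last by move=> i; rewrite in_setT.
rewrite -{1}[k.+1]subn0 -/(index_iota 0 k.+1) big_mkord; apply: eq_bigr => i _.
rewrite !coef_poly (leq_ltn_trans _ kK) ?leq_ord// (leq_ltn_trans _ kK) ?leq_subr//.
congr (_ * g _); have := leq_ord i; lia.
Qed.

Lemma bnd_conv (f g : int -> F) (N M : int) :
  bnd f N -> bnd g M -> bnd (conv f g) (N + M).
Proof.
move=> fN gM n NMn; rewrite /conv fsbig1 // => i _.
have [Ni|iN] := ltP N i; first by rewrite fN ?mul0r.
by rewrite gM ?mulr0//; lia.
Qed.

Lemma bounded_above_conv f g : conv f g \in @bounded_above F.
Proof.
have [N fN] := bnd_ex f; have [M gM] := bnd_ex g.
by apply/bounded_aboveP; exists (N + M); exact: bnd_conv.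
Qed.

Definition lmul f g : laurent F := Laurent (bounded_above_conv f g).

Lemma bounded_above_one : (fun n : int => (n == 0)%:R : F) \in @bounded_above F.
Proof. by apply/bounded_aboveP; exists 0 => n; case: eqP => // ->. Qed.

Definition lone : laurent F := Laurent bounded_above_one.

Lemma lmulE f g (N M : int) (k K : nat) : bnd f N -> bnd g M -> (k < K)%N ->
  lmul f g (N + M - k%:Z) = (ltrunc f N K * ltrunc g M K)`_k.
Proof. exact: convE. Qed.

Lemma bnd_lmul f g (N M : int) : bnd f N -> bnd g M -> bnd (lmul f g) (N + M).
Proof. exact: bnd_conv. Qed.

Lemma bnd_at f (n : int) : exists2 N, bnd f N & n <= N.
Proof.
have [N fN] := bnd_ex f; exists (Num.max N n); last by rewrite le_max lexx orbT.
by apply: bnd_le fN _; rewrite le_max lexx.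
Qed.

Lemma coefM_eq (p q r : {poly F}) k :
  (forall i, (i <= k)%N -> p`_i = q`_i) -> (p * r)`_k = (q * r)`_k.
Proof. by move=> pq; rewrite !coefM; apply: eq_bigr => i _; rewrite pq ?leq_ord. Qed.

Lemma ltrunc_mul f g N M (k K : nat) : bnd f N -> bnd g M -> (k < K)%N ->
  (ltrunc (lmul f g) (N + M) K)`_k = (ltrunc f N K * ltrunc g M K)`_k.
Proof. by move=> fN gM kK; rewrite coef_poly kK (lmulE (K := K)). Qed.

Lemma lmulC : commutative lmul.
Proof.
move=> f g; apply/laurentP/funext => n.
have [M gM _] := bnd_at g 0; have [N fN nN] := bnd_at f (n - M).
have [k ->] : exists k : nat, n = N + M - k%:Z by exists (absz (N + M - n)%R); lia.
rewrite (lmulE fN gM (ltnSn k)) [N + M]addrC (lmulE gM fN (ltnSn k)).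
by rewrite mulrC.
Qed.

Lemma lmulA : associative lmul.
Proof.
move=> f g h; apply/laurentP/funext => n.
have [M gM _] := bnd_at g 0; have [L hL _] := bnd_at h 0.
have [N fN nN] := bnd_at f (n - M - L).
have [k ->] : exists k : nat, n = N + M + L - k%:Z.
  by exists (absz (N + M + L - n)%R); lia.
rewrite (lmulE (bnd_lmul fN gM) hL (ltnSn k)).
rewrite -[N + M + L]addrA (lmulE fN (bnd_lmul gM hL) (ltnSn k)).
rewrite [in LHS]mulrC.
rewrite (coefM_eq (p := ltrunc (lmul f g) _ _)
  (q := ltrunc f N k.+1 * ltrunc g M k.+1)); last first.
  by move=> i ik; rewrite ltrunc_mul.
rewrite (coefM_eq (p := ltrunc (lmul g h) _ _)
  (q := ltrunc g M k.+1 * ltrunc h L k.+1)); last first.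
  by move=> i ik; rewrite ltrunc_mul.
by rewrite [in LHS]mulrC mulrA.
Qed.

Lemma lmul1 : left_id lone lmul.
Proof.
move=> f; apply/laurentP/funext => n.
have [N fN nN] := bnd_at f n.
have b1 : bnd lone 0 by move=> m m0 /=; case: eqP m0 => // ->.
have [k ->] : exists k : nat, n = 0 + N - k%:Z by exists `|N - n|%N; lia.
rewrite (lmulE b1 fN (ltnSn k)) (coefM_eq (q := 1)).
  by rewrite mul1r coef_poly ltnSn add0r.
move=> i ik; rewrite coef_poly ltnS ik coef1 /=; congr (nat_of_bool _)%:R; lia.
Qed.

Lemma lmulDl : left_distributive lmul +%R.
Proof.
move=> f g h; apply/laurentP/funext => n.
have [N1 fN1 _] := bnd_at f 0; have [N gN N1N] := bnd_at g N1.
have fN := bnd_le fN1 N1N.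
have [L hL nL] := bnd_at h (n - N).
have [k ->] : exists k : nat, n = N + L - k%:Z by exists (absz (N + L - n)%R); lia.
have fgN : bnd (f + g) N by move=> m Nm; rewrite laurentD fN ?gN ?addr0.
rewrite laurentD (lmulE fgN hL (ltnSn k)) (lmulE fN hL (ltnSn k)).
rewrite (lmulE gN hL (ltnSn k)) -coefD -mulrDl; apply: coefM_eq => i ik.
by rewrite coefD !coef_poly ltnS ik laurentD.
Qed.

Lemma lone_neq0 : lone != 0.
Proof.
apply/eqP => /(congr1 (fun f : laurent F => f 0)).
by rewrite laurent0 /= => /eqP; rewrite oner_eq0.
Qed.

HB.instance Definition _ := GRing.Zmodule_isComNzRing.Build (laurent F)
  lmulA lmulC lmul1 lmulDl lone_neq0.

Lemma laurent_lead f : f != 0 -> exists2 N, bnd f N & f N != 0.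
Proof.
move=> f0; have [M fM] := bnd_ex f.
have [m fm] : exists m, f m != 0.
  apply: contrapT => fz; move/eqP: f0; apply; apply/laurentP/funext => m.
  by apply/eqP; apply: contrapT => /negP fm; apply: fz; exists m.
have exk : exists k : nat, f (M - k%:Z) != 0.
  exists `|M - m|%N; suff -> : M - `|M - m|%N%:Z = m by [].
  have : m <= M by rewrite leNgt; apply: contra fm => /fM ->.
  lia.
have [k fk kmin] := ex_minnP exk.
exists (M - k%:Z) => // n kn; have [|nM] := ltP M n; first exact: fM.
apply/eqP; apply: contrapT => /negP fn.
have := kmin `|M - n|%N; rewrite (_ : M - _ = n); last by lia.
by move=> /(_ fn); lia.
Qed.

Section Inverse.
Variable a : nat -> F.

Fixpoint inv_series (k : nat) : seq F :=
  if k is k'.+1 then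
    let s := inv_series k' in
    rcons s ((a 0)^-1 * ((k' == 0%N)%:R - \sum_(i < k') s`_i * a (k' - i)%N))
  else [::].

Lemma size_inv_series k : size (inv_series k) = k.
Proof. by elim: k => //= k IH; rewrite size_rcons IH. Qed.

Lemma nth_inv_series i k : (i < k)%N ->
  (inv_series k)`_i = (inv_series i.+1)`_i.
Proof.
elim: k => // k IH; rewrite ltnS leq_eqVlt => /orP[/eqP -> //|ik].
by rewrite [in LHS]/= nth_rcons size_inv_series ik IH.
Qed.

Definition inv_coef (i : nat) : F := (inv_series i.+1)`_i.

Lemma inv_coefP k : a 0 != 0 ->
  \sum_(i < k.+1) inv_coef i * a (k - i)%N = (k == 0%N)%:R.
Proof.
move=> a0; rewrite big_ord_recr /= subnn {2}/inv_coef /= nth_rcons.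
rewrite size_inv_series ltnn eqxx mulrAC mulVf// mul1r addrC.
rewrite [X in _ - X](_ : _ = \sum_(i < k) inv_coef i * a (k - i)%N) ?subrK//.
by apply: eq_bigr => i _; rewrite nth_inv_series.
Qed.

End Inverse.

Lemma lmul_inv_ex f : f != 0 -> exists g : laurent F, g * f = 1.
Proof.
move=> /laurent_lead[N fN fN0].
pose a (k : nat) := f (N - k%:Z).
pose c (n : int) : F := if n <= - N then inv_coef a (absz (- N - n)%R) else 0.
have cN : bnd c (- N) by move=> n; rewrite ltNge /c => /negbTE ->.
have cP : c \in @bounded_above F by apply/bounded_aboveP; exists (- N).
exists (Laurent cP); apply/laurentP/funext => n.
have [n0|n0] := ltP 0 n.
  transitivity (0 : F); first by apply: (@bnd_lmul (Laurent cP) f _ _ cN fN); lia.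
  by move: n0 => /=; case: eqP => // ->.
have [k ->] : exists k : nat, n = - N + N - k%:Z by exists `|n|%N; lia.
transitivity ((k == 0%N)%:R : F); last first.
  by rewrite /=; congr (nat_of_bool _)%:R; lia.
rewrite [LHS](@lmulE (Laurent cP) f _ _ k k.+1 cN fN (ltnSn k)) coefM.
rewrite -(@inv_coefP a k) /a ?subr0//; apply: eq_bigr => i _.
have ik := leq_ord i; rewrite !coef_poly ltn_ord ltnS leq_subr /= /c.
rewrite (_ : _ <= _ = true); last by lia.
by congr (inv_coef _ _ * _); lia.
Qed.

Definition linv f : laurent F := xget 0 [set g | g * f = 1].

Lemma lmulVf f : f != 0 -> linv f * f = 1.
Proof. by move=> /lmul_inv_ex[g fg]; rewrite /linv; case: xgetP => // /(_ g). Qed.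

Lemma linv0 : linv 0 = 0.
Proof.
rewrite /linv; case: xgetP => // g _ /= /eqP.
by rewrite mulr0 eq_sym oner_eq0.
Qed.

HB.instance Definition _ := GRing.ComNzRing_isField.Build (laurent F)
  lmulVf linv0.

Lemma laurentM f g n : (f * g) n = \sum_(i \in [set: int]) f i * g (n - i).
Proof. by []. Qed.

Lemma laurent1 n : (1 : laurent F) n = (n == 0)%:R.
Proof. by []. Qed.

End LaurentField.

Section DegreeTopology.
Variable F : fieldType.
Implicit Types f g : laurent F.

(* The set below has at most one element, and is empty exactly for f = 0. *)
Definition ldeg f : \bar int :=
  xget -oo%E [set N%:E | N in [set N : int | f N != 0 /\ bnd f N]].

(* The values q^n of |.| are cofinal at 0, so these are the open sets for the
   distance |f - g|, stated without reference to a field of real numbers. *)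
Definition laurent_open : set_system (laurent F) :=
  [set U | forall f, U f ->
     exists n : int, forall g, (ldeg (g - f)%R < n%:E)%E -> U g].

Lemma laurent_openT : laurent_open setT.
Proof. by move=> f _; exists 0. Qed.

Lemma laurent_openI : setI_closed laurent_open.
Proof.
move=> U V oU oV f [/oU[n Un] /oV[m Vm]]; exists (Num.min n m) => g.
move=> gf; split; [apply: Un | apply: Vm]; apply: lt_le_trans gf _.
  by rewrite lee_fin ge_min lexx.
by rewrite lee_fin ge_min lexx orbT.
Qed.

Lemma laurent_open_bigcup (I : Type) (U : I -> set (laurent F)) :
  (forall i, laurent_open (U i)) -> laurent_open (\bigcup_i U i).
Proof.
by move=> oU f [i _ /(oU i)[n Un]]; exists n => g /Un; exists i.
Qed.

HB.instance Definition _ := isPointed.Build (laurent F) 0.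

HB.instance Definition _ := isOpenTopological.Build (laurent F)
  laurent_openT laurent_openI laurent_open_bigcup.

Definition laurent_display : measure_display.
Proof. exact. Qed.

Let borel : set_system (laurent F) := <<s [set U | open U] >>.

Let borel0 : borel set0. Proof. exact: sigma_algebra0. Qed.

Let borelC A : borel A -> borel (~` A). Proof. exact: sigma_algebraC. Qed.

Let borel_bigcup (U : (set (laurent F))^nat) :
  (forall i, borel (U i)) -> borel (\bigcup_i U i).
Proof. exact: sigma_algebra_bigcup. Qed.

HB.instance Definition _ := @isMeasurable.Build laurent_display
  (laurent F) borel borel0 borelC borel_bigcup.

Lemma bounded_above_poly (P : {poly F}) :
  (fun n : int => if n is Posz k then P`_k else 0) \in @bounded_above F.
Proof.
apply/bounded_aboveP; exists (size P) => -[k|//] Pk.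
by rewrite nth_default//; apply: ltnW.
Qed.

Definition laurent_of_poly (P : {poly F}) : laurent F :=
  Laurent (bounded_above_poly P).

End DegreeTopology.

Notation "P %:L" := (laurent_of_poly P)
  (at level 1, left associativity, format "P %:L") : ring_scope.

Section AbsoluteValue.
Variables (R : realType) (F : finFieldType).

Definition labs (f : laurent F) : R :=
  if ldeg f is EFin n then #|F|%:R ^ n else 0.

Definition lball (g : laurent F) (r : R) : set (laurent F) :=
  [set f | labs (f - g) < r].

Definition lfrac_part : set (laurent F) := [set f | (ldeg f < 0%:E)%E].

(* Regularity is not required: it is automatic for a Borel measure finite on
   compact sets, the space being locally compact and second countable. *)
Definition haar_measure (mu : set (laurent F) -> \bar R) : Prop :=
  [/\ mu setT != 0%E,
      forall K : set (laurent F), compact K -> (mu K < +oo)%E &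
      forall (g : laurent F) (A : set (laurent F)), measurable A ->
        mu [set g + f | f in A] = mu A].

End AbsoluteValue.

Section PowerMeasure.
Variables (R : realType) (dT : measure_display) (T : measurableType dT).
Variable mu : set T -> \bar R.

(* For a sigma-finite mu, such as a Haar measure on [laurent F], this is the
   unique measure on n.-tuple T giving \prod_i mu (A i) to measurable boxes. *)
Fixpoint power_measure (n : nat) : set (n.-tuple T) -> \bar R :=
  match n with
  | 0 => \d_[tuple of [::]]
  | n'.+1 => pushforward (mu \x @power_measure n')%E
               (fun p : T * n'.-tuple T => [tuple of p.1 :: p.2])
  end.

End PowerMeasure.

Arguments power_measure {R dT T} mu n A : rename.

Section LimsupSet.
Variables (R : realType) (F : finFieldType) (d : nat) (Psi : {poly F} -> R).

(* gcd(P_1, ..., P_d, Q) = 1; as Q will be monic, [size P < size Q] is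
   deg P < deg Q including the case P = 0. *)
Definition numerators (Q : {poly F}) : set (d.-tuple {poly F}) :=
  [set P : d.-tuple {poly F} | (forall i, (size (tnth P i) < size Q)%N) /\
           coprimep (\big[@gcdp F/0]_(i < d) tnth P i) Q].

Definition HQ (Q : {poly F}) : set (d.-tuple (laurent F)) :=
  [set x | forall i, @lfrac_part F (tnth x i)] `&`
  \bigcup_(P in numerators Q)
    [set x | forall i, lball ((tnth P i)%:L / Q%:L) (Psi Q / labs R Q%:L)
                             (tnth x i)].

Definition Hlimsup : set (d.-tuple (laurent F)) :=
  \bigcap_(n in [set n : nat | (1 <= n)%N])
    \bigcup_(Q in [set Q : {poly F} | Q \is monic /\ (n <= (size Q).-1)%N])
      HQ Q.

End LimsupSet.

Arguments lfrac_part F : clear implicits.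
Arguments HQ {R F} d Psi Q x : rename.
Arguments Hlimsup {R F} d Psi x : rename.

(* Main.v *)
Require Import Defs.
From HB Require Import structures.
From mathcomp Require Import all_boot all_order all_algebra.
From mathcomp Require Import all_classical all_reals all_analysis.
From mathcomp Require Import zify ring lra.

Set Implicit Arguments.
Unset Strict Implicit.
Unset Printing Implicit Defensive.
Import Order.TTheory GRing.Theory Num.Theory.

Local Open Scope classical_set_scope.
Local Open Scope ring_scope.

(* Convergence is Borel-Cantelli.  For divergence, put |Psi(Q)| = q^-l(Q) <= 1
   up to truncation, so that H_Q has measure comparable to w_Q = q^(-d l(Q)):
   since d >= 2, a positive proportion of all numerators is coprime to Q.  For
   Q <> Q' the sets H_Q and H_Q' meet in measure at most w_Q w_Q', because two
   distinct reduced fractions cannot coincide.  Bonferroni's inequality then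
   gives measure at least 3/128 for the limsup set, a bound that does not
   change when all radii are multiplied by the same q^-v.  The intersection E
   over v of these limsup sets thus still has measure at least 3/128, and it
   is mapped into itself by the shears x_i += X^N x_j of the torus, which act
   on reduced fractions with denominator Q.  The shears preserve the measure
   and are mixing as N grows, so E has measure 1. *)

(** * Digits of Laurent series *)

Section Digits.
Variable F : fieldType.
Implicit Types (f g : laurent F) (P Q : {poly F}).

Lemma ldeg_lead f (N : int) : bnd f N -> f N != 0 -> ldeg f = N%:E.
Proof.
move=> fN fN0; rewrite /ldeg (_ : [set _ | _ in _] = [set N%:E]).
  by apply: xget_unique => [|y ->].
apply/seteqP; split=> [_ [M [fM0 fM] <-]|_ ->]; last by exists N.
congr EFin; apply/eqP; rewrite eq_le !leNgt; apply/andP; split; apply/negP.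
  by move/fN => e; rewrite e eqxx in fM0.
by move/fM => e; rewrite e eqxx in fN0.
Qed.

Lemma ldeg0 : ldeg (0 : laurent F) = -oo%E.
Proof. by rewrite /ldeg; case: xgetP => [y ->|_]; [case=> N [/eqP]|]. Qed.

Lemma ldegP f (n : int) : (ldeg f < n%:E)%E <-> bnd f (n - 1).
Proof.
have [->|f0] := eqVneq f 0.
  by split=> [_ m _ //|_]; rewrite ldeg0 ltNyr.
have [N fN fN0] := laurent_lead f0.
rewrite (ldeg_lead fN fN0) lte_fin; split=> [Nn|fn]; first by apply: bnd_le fN _; lia.
rewrite ltNge; apply/negP => nN; have := fn N; rewrite (_ : _ < _ = true); last by lia.
by move=> /(_ isT) e; rewrite e eqxx in fN0.
Qed.

Lemma bndD f g (N : int) : bnd f N -> bnd g N -> bnd (f + g) N.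
Proof. by move=> fN gN m Nm; rewrite laurentD fN ?gN ?addr0. Qed.

Lemma bndN f (N : int) : bnd f N -> bnd (- f) N.
Proof. by move=> fN m Nm; rewrite laurentN fN ?oppr0. Qed.

Lemma bndB f g (N : int) : bnd f N -> bnd g N -> bnd (f - g) N.
Proof. by move=> fN gN; apply: bndD => //; exact: bndN. Qed.

Lemma bndM f g (N M : int) : bnd f N -> bnd g M -> bnd (f * g) (N + M).
Proof. exact: bnd_lmul. Qed.

Lemma coef_bndM f g (N M : int) : bnd f N -> bnd g M ->
  (f * g) (N + M) = f N * g M.
Proof.
move=> fN gM; have := lmulE fN gM (ltnSn 0).
by rewrite subr0 coefM big_ord1 !coef_poly /= !subr0.
Qed.

Lemma polyL_coef P (k : nat) : P%:L k%:Z = P`_k. Proof. by []. Qed.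

Lemma polyL_neg P (n : int) : n < 0 -> P%:L n = 0. Proof. by case: n. Qed.

Lemma polyLD P Q : (P + Q)%:L = P%:L + Q%:L.
Proof.
by apply/laurentP/funext => -[k|k]; rewrite laurentD ?polyL_coef ?coefD ?polyL_neg// addr0.
Qed.

Lemma polyLN P : (- P)%:L = - P%:L.
Proof.
by apply/laurentP/funext => -[k|k]; rewrite laurentN ?polyL_coef ?coefN ?polyL_neg// oppr0.
Qed.

Lemma polyLB P Q : (P - Q)%:L = P%:L - Q%:L.
Proof. by rewrite polyLD polyLN. Qed.

Lemma polyLM P Q : (P * Q)%:L = P%:L * Q%:L.
Proof.
apply/laurentP/funext => n; rewrite laurentM; case: n => [k|k]; last first.
  rewrite polyL_neg// fsbig1// => i _.
  have [i0|i0] := ltP i 0; first by rewrite polyL_neg ?mul0r.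
  by rewrite (@polyL_neg Q) ?mulr0//; lia.
rewrite (fsbigE [seq Posz i | i <- iota 0 k.+1]) //; last first.
- move=> i _ iP.
  have [i0|i0] := ltP i 0; first by rewrite polyL_neg ?mul0r.
  have [ik|ki] := ltP k%:Z i; first by rewrite (@polyL_neg Q) ?mulr0//; lia.
  exfalso; move: iP; apply/negP; rewrite negbK; apply/mapP; exists `|i|%N; last by lia.
  by rewrite mem_iota; lia.
- by rewrite map_inj_uniq ?iota_uniq// => i j [].
rewrite big_map polyL_coef coefM (eq_bigl predT); last by move=> i; rewrite in_setT.
apply/esym; rewrite -{1}[k.+1]subn0 -/(index_iota 0 k.+1) big_mkord; apply: eq_bigr => i _.
by rewrite polyL_coef (_ : k%:Z - i%:Z = (k - i)%N); last by have := leq_ord i; lia.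
Qed.

Lemma bnd_polyL P (n : nat) : bnd P%:L (n%:Z - 1) <-> (size P <= n)%N.
Proof.
split=> [Pn|Pn [k|k] nk]; last 2 first.
- by rewrite polyL_coef nth_default//; apply: leq_trans Pn _; lia.
- by rewrite polyL_neg.
by apply/leq_sizeP => j nj; rewrite -polyL_coef Pn//; lia.
Qed.

Lemma polyL_eq0 P : (P%:L == 0) = (P == 0).
Proof.
apply/eqP/eqP => [P0|->]; last first.
  by apply/laurentP/funext => -[k|k]; rewrite ?polyL_coef ?coef0.
by apply/polyP => k; rewrite coef0 -polyL_coef P0.
Qed.

Lemma bndM_monic f Q (N : int) : Q \is monic ->
  bnd (f * Q%:L) (N + (size Q).-1%:Z) <-> bnd f N.
Proof.
move=> Qm; have bQ : bnd Q%:L (size Q).-1.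
  apply: bnd_le (proj2 (bnd_polyL Q (size Q)) (leqnn _)) _.
  by rewrite -[X in X%:Z - 1]prednK ?size_poly_gt0 ?monic_neq0//; lia.
split=> [fQ|fN]; last exact: bndM.
have [->//|f0] := eqVneq f 0.
have [M fM fM0] := laurent_lead f0.
apply: (bnd_le fM); rewrite leNgt; apply/negP => NM.
have := coef_bndM fM bQ; rewrite fQ; last by lia.
rewrite polyL_coef -/(lead_coef Q) (monicP Qm) mulr1 => e.
by rewrite -e eqxx in fM0.
Qed.

Lemma coef_polyLXn_mul f (N : nat) (m : int) :
  (('X^N)%:L * f) m = f (m - N%:Z).
Proof.
rewrite laurentM (fsbigE [:: N%:Z])//.
  by rewrite big_cons big_nil in_setT /= addr0 coefXn eqxx mul1r.
move=> i _; rewrite inE => iN; have [i0|i0] := ltP i 0.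
  by rewrite polyL_neg ?mul0r.
rewrite -[i]gez0_abs// polyL_coef coefXn.
by rewrite (_ : _ == _ = false) ?mul0r//; apply/eqP; lia.
Qed.

Definition tr (N : nat) f : 'rV[F]_N := \row_(j < N) f (- j.+1%:Z).

Lemma trD N f g : tr N (f + g) = tr N f + tr N g.
Proof. by apply/rowP => j; rewrite !mxE laurentD. Qed.

Lemma trN N f : tr N (- f) = - tr N f.
Proof. by apply/rowP => j; rewrite !mxE laurentN. Qed.

Lemma trB N f g : tr N (f - g) = tr N f - tr N g.
Proof. by rewrite trD trN. Qed.

Lemma tr_polyL N P : tr N P%:L = 0.
Proof. by apply/rowP => j; rewrite !mxE polyL_neg. Qed.

Lemma tr_eqP N f g : tr N f = tr N g <->
  (forall j, (j < N)%N -> f (- j.+1%:Z) = g (- j.+1%:Z)).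
Proof.
split=> [fg j jN|fg]; last by apply/rowP => j; rewrite !mxE fg.
by have /rowP/(_ (Ordinal jN)) := fg; rewrite !mxE.
Qed.

Lemma tr_le N M f g : (M <= N)%N -> tr N f = tr N g -> tr M f = tr M g.
Proof.
by move=> MN /tr_eqP fg; apply/tr_eqP => j jM; apply: fg; exact: leq_trans MN.
Qed.

Lemma tr_bnd N f g : bnd f (-1) -> bnd g (-1) ->
  (tr N f = tr N g <-> bnd (f - g) (- N.+1%:Z)).
Proof.
move=> f1 g1; rewrite tr_eqP; split=> fg => [n Nn|j jN].
  have [n0|n0] := ltP (-1) n; first by rewrite (bndB f1 g1).
  rewrite laurentD laurentN (_ : n = - (absz n).-1.+1%:Z); last by lia.
  by rewrite fg ?subrr//; lia.
by apply/eqP; rewrite -subr_eq0 -laurentN -laurentD; apply/eqP/fg; lia.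
Qed.

Lemma bounded_above_row (N : nat) (a : 'rV[F]_N) :
  (fun n : int => if n is Negz k then
     (if insub k is Some j then a 0 j else 0) else 0) \in @bounded_above F.
Proof. by apply/bounded_aboveP; exists 0 => -[k|k]. Qed.

Definition ofr (N : nat) (a : 'rV[F]_N) : laurent F := Laurent (bounded_above_row a).

Lemma ofr_coef N (a : 'rV[F]_N) (j : 'I_N) : ofr a (- j.+1%:Z) = a 0 j.
Proof. by rewrite -NegzE /= valK. Qed.

Lemma tr_ofr N (a : 'rV[F]_N) : tr N (ofr a) = a.
Proof. by apply/rowP => j; rewrite mxE ofr_coef. Qed.

Lemma bnd_ofr N (a : 'rV[F]_N) : bnd (ofr a) (-1).
Proof. by case=> // n; lia. Qed.

Lemma divXn_ex (N : nat) f : exists g, (forall m, g m = f (m + N%:Z)).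
Proof.
have bf : (fun m : int => f (m + N%:Z)) \in @bounded_above F.
  have [M fM] := bnd_ex f; apply/bounded_aboveP; exists M => m Mm.
  by rewrite fM//; lia.
by exists (Laurent bf).
Qed.

End Digits.

Lemma lfrac_partP (F : finFieldType) (f : laurent F) :
  lfrac_part F f <-> bnd f (-1).
Proof. by rewrite -[-1]add0r; exact: ldegP. Qed.

(** * Powers of a sigma-finite measure *)

Section PowerMeasureProperties.
Variables (R : realType) (dT : measure_display) (T : measurableType dT).
Variable mu : {sigma_finite_measure set T -> \bar R}.

Lemma measurable_cons_pair n :
  measurable_fun setT (fun p : T * n.-tuple T => [tuple of p.1 :: p.2]).
Proof. exact: measurable_cons. Qed.

Lemma power_measure_sigma_finite n :
  exists m : {sigma_finite_measure set (n.-tuple T) -> \bar R},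
    (m : set _ -> \bar R) = power_measure mu n.
Proof.
elim: n => [|n [m IH]].
  by exists (\d_[tuple of [::]]).
pose f (p : T * n.-tuple T) := [tuple of p.1 :: p.2].
have mf := @measurable_cons_pair n.
pose pm : {measure set (n.+1.-tuple T) -> \bar R} :=
  measure_function_pushforward__canonical__measure_function_Measure (mu \x m)%E mf.
have sf : sigma_finite setT pm.
  have /sigma_finiteP[A [TA ndA Aoo]] := sigma_finiteT mu.
  have /sigma_finiteP[B [TB ndB Boo]] := sigma_finiteT m.
  pose g (x : n.+1.-tuple T) := (thead x, [tuple of behead x]).
  have mg : measurable_fun setT g.
    apply/measurable_fun_pairP; split; last exact: measurable_behead.
    exact: (measurable_tnth ord0).
  have gf p : g (f p) = p by case: p => x y; congr pair; apply: val_inj.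
  exists (fun k => g @^-1` (A k `*` B k)).
    apply/seteqP; split=> // x _.
    have : (\bigcup_k A k) (g x).1 by rewrite -TA.
    have : (\bigcup_k B k) (g x).2 by rewrite -TB.
    move=> [j _ Bj] [i _ Ai]; exists (maxn i j) => //; split.
      by move: Ai; exact/subsetPset/ndA/leq_maxl.
    by move: Bj; exact/subsetPset/ndB/leq_maxr.
  move=> k; have [mA Ak] := Aoo k; have [mB Bk] := Boo k; split.
    by rewrite -[X in measurable X]setTI; apply: mg => //; exact: measurableX.
  have -> : pm (g @^-1` (A k `*` B k)) = (mu \x m)%E ((g \o f) @^-1` (A k `*` B k)) by [].
  rewrite (_ : g \o f = id); last by apply/funext => p; exact: gf.
  by rewrite product_measure1E// lte_mul_pinfty// ge0_fin_numE.
pose sm : {sigma_finite_measure set _ -> \bar R} :=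
  HB.pack (pm : set _ -> \bar R) (Measure.class pm) (Measure_isSigmaFinite.Build _ _ _ pm sf).
exists sm.
by rewrite /= -IH.
Qed.

Lemma measurable_box n (B : 'I_n -> set T) : (forall i, measurable (B i)) ->
  measurable [set x : n.-tuple T | forall i, B i (tnth x i)].
Proof.
move=> mB; rewrite (_ : [set _ | _] =
    \bigcap_(i in [set: 'I_n]) ((tnth (T:=T))^~ i @^-1` B i)); last first.
  by apply/seteqP; split=> x /= xB i; [move=> _|]; exact: xB.
apply: fin_bigcap_measurable => // i _.
by rewrite -[X in measurable X]setTI; apply: (@measurable_tnth _ T n i).
Qed.

Lemma power_measure_box n (B : 'I_n -> set T) (c : R) :
  (forall i, measurable (B i)) -> (forall i, mu (B i) = c%:E) ->
  power_measure mu n [set x | forall i, B i (tnth x i)] = (c ^+ n)%:E.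
Proof.
elim: n B => [|n IH] B mB Bc.
  by rewrite /= diracE mem_set//= => -[].
have [m mE] := power_measure_sigma_finite n.
rewrite /= -mE /pushforward (_ : _ @^-1` _ =
    B ord0 `*` [set x | forall i, B (lift ord0 i) (tnth x i)]); last first.
  apply/seteqP; split=> -[x y] /=.
    move=> xB; split=> [|i]; first by have := xB ord0.
    by have := xB (lift ord0 i); rewrite tnthS.
  move=> [xB yB] i; have [j ->|->//] := unliftP ord0 i.
  by rewrite tnthS.
rewrite product_measure1E//; last exact: (@measurable_box _ (fun i => B (lift ord0 i))).
by rewrite mE (IH (fun i => B (lift ord0 i)))// exprS EFinM; congr (_ * _)%E; exact: Bc.
Qed.

End PowerMeasureProperties.

Lemma measure_fintype d (T : measurableType d) (R : realType)
    (mu : {measure set T -> \bar R}) (I : finType) (D : {pred I}) (A : I -> set T) :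
  (forall i, measurable (A i)) -> trivIset setT A ->
  mu (\bigcup_(i in [set` D]) A i) = (\sum_(i in D) mu (A i))%E.
Proof.
move=> mA tA; rewrite (_ : [set` D] = [set` enum D]); last first.
  by apply/seteqP; split=> i /=; rewrite mem_enum.
rewrite measure_fin_bigcup//; last exact: sub_trivIset tA.
by rewrite -fsbig_seq ?enum_uniq// big_enum.
Qed.

Section HaarCells.
Variables (R : realType) (F : finFieldType).
Variable nu : {measure set (laurent F) -> \bar R}.
Hypothesis nu_haar : haar_measure nu.
Hypothesis nu_L : nu (lfrac_part F) = 1%E.

Lemma measurable_open (A : set (laurent F)) : open A -> measurable A.
Proof. by move=> oA; exact: sub_sigma_algebra. Qed.

Lemma open_lfrac_part : open (lfrac_part F).
Proof.
suff : laurent_open (lfrac_part F) by [].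
move=> f /lfrac_partP f1; exists 0 => g /ldegP; rewrite sub0r => gf1.
by apply/lfrac_partP; rewrite -[g](subrK f); exact: bndD.
Qed.

Lemma open_tr N (a : 'rV[F]_N) : open [set f | tr N f = a].
Proof.
suff : laurent_open [set f | tr N f = a] by [].
move=> f <-; exists (- N%:Z) => g /ldegP gf; apply/tr_eqP => j jN.
by apply/eqP; rewrite -subr_eq0 -laurentN -laurentD; apply/eqP/gf; lia.
Qed.

Definition cell N (a : 'rV[F]_N) : set (laurent F) :=
  lfrac_part F `&` [set f | tr N f = a].

Lemma measurable_cell N (a : 'rV[F]_N) : measurable (cell a).
Proof.
by apply: measurableI; apply: measurable_open; [exact: open_lfrac_part|exact: open_tr].
Qed.

Lemma nu_translate (g : laurent F) (A : set (laurent F)) : measurable A ->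
  nu [set g + f | f in A] = nu A.
Proof. by case: nu_haar => _ _; exact. Qed.

Lemma nu_cell N (a : 'rV[F]_N) : nu (cell a) = (#|F|%:R ^- N)%:E.
Proof.
have trans (b : 'rV[F]_N) : nu (cell b) = nu (@cell N 0).
  rewrite -(nu_translate (ofr b) (measurable_cell 0)); congr (nu _).
  apply/seteqP; split=> [f [/lfrac_partP f1 fb]|_ [f [/lfrac_partP f1 f0] <-]].
    exists (f - ofr b); last by rewrite addrCA subrr addr0.
    split; last by rewrite /= trB tr_ofr fb subrr.
    by apply/lfrac_partP/bndB => //; exact: bnd_ofr.
  split; last by rewrite /= trD tr_ofr f0 addr0.
  by apply/lfrac_partP/bndD => //; exact: bnd_ofr.
have := nu_L; rewrite (_ : lfrac_part F =
    \bigcup_(b in [set` [pred _ : 'rV[F]_N | true]]) cell b); last first.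
  by apply/seteqP; split=> [f fL|f [b _ []]]//; exists (tr N f).
have tcell : trivIset setT (@cell N).
  by apply/trivIsetP => b c _ _ bc; apply/seteqP; split=> // f [[_ /= fb] [_ /= fc]];
    move: bc; rewrite -fb fc eqxx.
rewrite (measure_fintype nu _ (@measurable_cell N) tcell).
rewrite (eq_bigr (fun=> nu (cell a)));
  last by move=> b _; exact: etrans (trans b) (esym (trans a)).
have fin : nu (cell a) \is a fin_num.
  rewrite ge0_fin_numE// (@le_lt_trans _ _ (nu (lfrac_part F)))//; last by rewrite nu_L ltry.
  rewrite le_measure ?inE//; [exact: measurable_cell| |exact: subIsetl].
  exact: measurable_open open_lfrac_part.
rewrite -(fineK fin) sumEFin sumr_const => -[].
have -> : #|[pred _ : 'rV[F]_N | true]| = (#|F| ^ N)%N.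
  by rewrite -[X in (_ ^ X)%N]mul1n -card_mx; apply: eq_card.
move=> nu1; congr EFin.
have q0 : (#|F|%:R ^+ N : R) != 0.
  by rewrite expf_neq0// pnatr_eq0 -lt0n (leq_trans _ (card_finNzRing_gt1 F)).
by apply: (mulIf q0); rewrite mulVf// -natrX mulr_natr.
Qed.

End HaarCells.

(** * Cylinder sets and the torus measure *)

Section HaarSigmaFinite.
Variables (R : realType) (F : finFieldType).
Variable nu : {measure set (laurent F) -> \bar R}.
Hypothesis nu_haar : haar_measure nu.
Hypothesis nu_L : nu (lfrac_part F) = 1%E.

Lemma open_translate_lfrac_part (g : laurent F) :
  open [set g + f | f in lfrac_part F].
Proof.
suff : laurent_open [set g + f | f in lfrac_part F] by [].
move=> _ [f /lfrac_partP f1 <-]; exists 0 => h /ldegP; rewrite sub0r => hf.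
exists (h - g); last by rewrite addrCA subrr addr0.
apply/lfrac_partP; rewrite (_ : h - g = (h - (g + f)) + f).
  exact: bndD.
by rewrite opprD addrA subrK.
Qed.

Lemma poly_part_ex (f : laurent F) : exists P : {poly F}, bnd (f - P%:L) (-1).
Proof.
have [N fN N0] := bnd_at f 0.
exists (\poly_(k < `|N|%N.+1) f k%:Z) => -[k|[|k]]// _.
rewrite laurentD laurentN polyL_coef coef_poly.
by case: ltnP => kN; rewrite ?subrr// fN ?subr0//; lia.
Qed.

Lemma haar_sigma_finite : sigma_finite setT nu.
Proof.
exists (fun k => if unpickle k is Some P then
  [set (P : {poly F})%:L + f | f in lfrac_part F] else set0).
  apply/seteqP; split=> // f _; have [P fP] := poly_part_ex f.
  exists (pickle P) => //; rewrite pickleK; exists (f - P%:L).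
    exact/lfrac_partP.
  by rewrite addrCA subrr addr0.
move=> k; case: unpickle => [P|] /=; last by rewrite measure0.
split; first by apply: measurable_open; exact: open_translate_lfrac_part.
rewrite (nu_translate nu_haar) ?nu_L ?ltry//.
by apply: measurable_open; exact: open_lfrac_part.
Qed.

End HaarSigmaFinite.

Section Cylinders.
Variables (F : finFieldType) (d : nat).
Local Notation T := (d.-tuple (laurent F)).

Definition Tr N (x : T) : {ffun 'I_d -> 'rV[F]_N} := [ffun i => tr N (tnth x i)].

(* Such sets are invariant under translation by vectors of polynomials, since
   [Tr] only sees the coefficients of negative powers of X. *)
Definition level N (W : set T) := forall x y, Tr N x = Tr N y -> W x -> W y.

Definition cylinder : set (set T) := [set W | exists N, level N W].

Definition unit_cube : set T := [set x | forall i, lfrac_part F (tnth x i)].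

Definition ofTr N (a : {ffun 'I_d -> 'rV[F]_N}) : T := [tuple ofr (a i) | i < d].

Lemma TrP N x y : Tr N x = Tr N y <-> forall i, tr N (tnth x i) = tr N (tnth y i).
Proof.
split=> [xy i|xy]; first by have /ffunP/(_ i) := xy; rewrite !ffunE.
by apply/ffunP => i; rewrite !ffunE.
Qed.

Lemma Tr_ofTr N a : Tr N (ofTr a) = a.
Proof. by apply/ffunP => i; rewrite ffunE tnth_mktuple tr_ofr. Qed.

Lemma Tr_le N M x y : (M <= N)%N -> Tr N x = Tr N y -> Tr M x = Tr M y.
Proof. by move=> MN /TrP xy; apply/TrP => i; exact: tr_le MN (xy i). Qed.

Lemma level_le N M W : (M <= N)%N -> level M W -> level N W.
Proof. by move=> MN lW x y /(Tr_le MN); exact: lW. Qed.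

Lemma levelC N W : level N W -> level N (~` W).
Proof. by move=> lW x y xy nW Wy; apply: nW; exact: lW (esym xy) Wy. Qed.

Lemma levelI N W V : level N W -> level N V -> level N (W `&` V).
Proof. by move=> lW lV x y xy [Wx Vx]; split; [exact: lW Wx|exact: lV Vx]. Qed.

Lemma levelU N W V : level N W -> level N V -> level N (W `|` V).
Proof. by move=> lW lV x y xy [Wx|Vx]; [left; exact: lW Wx|right; exact: lV Vx]. Qed.

Lemma level_Tr N M a : (M <= N)%N -> level N (Tr M @^-1` [set a]).
Proof. by move=> MN x y xy /= <-; exact/esym/(Tr_le MN). Qed.

Lemma cylinderI : setI_closed cylinder.
Proof.
move=> W V [N lW] [M lV]; exists (maxn N M).
by apply: levelI; [apply: level_le lW; exact: leq_maxl|apply: level_le lV; exact: leq_maxr].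
Qed.

Lemma cylinderT : cylinder setT. Proof. by exists 0%N. Qed.

Lemma measurable_Tr N a : measurable (Tr N @^-1` [set a]).
Proof.
rewrite (_ : _ @^-1` _ = [set x : T | forall i, [set f | tr N f = a i] (tnth x i)]).
  apply: (measurable_box (B := fun i => [set f | tr N f = a i])) => i /=.
  by apply: measurable_open; exact: open_tr.
apply/seteqP; split=> x /=; first by move=> <- i; rewrite ffunE.
by move=> xa; apply/ffunP => i; rewrite ffunE.
Qed.

Lemma measurable_unit_cube : measurable unit_cube.
Proof.
apply: (measurable_box (B := fun=> lfrac_part F)) => i.
by apply: measurable_open; exact: open_lfrac_part.
Qed.

Lemma level_bigcup N W : level N W ->
  W = \bigcup_(a in [set` [pred a | `[< W (ofTr a) >]]]) (Tr N @^-1` [set a]).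
Proof.
move=> lW; apply/seteqP; split=> [x Wx|x [a /= /asboolP Wa xa]].
  exists (Tr N x) => //=; apply/asboolP; apply: lW Wx; by rewrite Tr_ofTr.
by apply: lW Wa; rewrite Tr_ofTr.
Qed.

Lemma measurable_level N W : level N W -> measurable W.
Proof.
move=> /level_bigcup ->; apply: fin_bigcup_measurable; first exact: finite_finset.
by move=> a _; exact: measurable_Tr.
Qed.

Lemma cylinder_measurable : <<s cylinder >> `<=` @measurable _ T.
Proof.
apply: smallest_sub; first exact: sigma_algebra_measurable.
by move=> W [N]; exact: measurable_level.
Qed.

End Cylinders.

Notation cylType F d := (g_sigma_algebraType (@cylinder F d)).

Section TorusMeasure.
Variables (R : realType) (F : finFieldType).
Variable nu : {measure set (laurent F) -> \bar R}.
Hypothesis nu_haar : haar_measure nu.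
Hypothesis nu_L : nu (lfrac_part F) = 1%E.

Lemma torus_measure_ex d : exists P : probability (cylType F d) R,
  (forall N a, P (@Tr F d N @^-1` [set a]) = ((#|F|%:R ^- N) ^+ d)%:E) /\
  (forall A : set (d.-tuple (laurent F)), P A = power_measure nu d (A `&` @unit_cube F d)).
Proof.
pose nu0 : {measure set (laurent F) -> \bar R} := mrestr nu measurableT.
have nu0E : (nu0 : set _ -> \bar R) = nu by apply/funext => A; rewrite /nu0 /= /mrestr setIT.
have sf0 : sigma_finite setT nu0 by rewrite nu0E; exact: haar_sigma_finite.
pose snu : {sigma_finite_measure set (laurent F) -> \bar R} :=
  HB.pack (nu0 : set _ -> \bar R) (Measure.class nu0)
    (Measure_isSigmaFinite.Build _ _ _ nu0 sf0).
have snuE : (snu : set _ -> \bar R) = nu := nu0E.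
have [m] := power_measure_sigma_finite snu d; rewrite snuE => mE.
have box (B : 'I_d -> set (laurent F)) (c : R) : (forall i, measurable (B i)) ->
    (forall i, nu (B i) = c%:E) ->
    power_measure nu d [set x | forall i, B i (tnth x i)] = (c ^+ d)%:E.
  move=> mB Bc; rewrite -snuE; apply: power_measure_box => // i.
  by rewrite -(Bc i) -snuE.
pose mU : {measure set (d.-tuple (laurent F)) -> \bar R} :=
  mrestr m (@measurable_unit_cube F d).
pose f (x : d.-tuple (laurent F)) : cylType F d := x.
have mf : measurable_fun setT f.
  by move=> _ B mB; rewrite setTI; exact: cylinder_measurable mB.
pose pm : {measure set (cylType F d) -> \bar R} :=
  measure_function_pushforward__canonical__measure_function_Measure mU mf.
have pmE A : pm A = power_measure nu d (A `&` @unit_cube F d).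
  by rewrite /pm /= /pushforward /mU /= /mrestr mE.
have pm1 : pm setT = 1%E.
  rewrite pmE setTI (box (fun=> lfrac_part F) 1).
  - by rewrite expr1n.
  - by move=> i; by apply: measurable_open; exact: open_lfrac_part.
  - by move=> _; exact: nu_L.
pose P : probability (cylType F d) R :=
  HB.pack (pm : set _ -> \bar R) (Measure.class pm) (Measure_isProbability.Build _ _ _ pm pm1).
exists P; split=> [N a|A]; last exact: pmE.
rewrite [LHS]pmE (_ : _ `&` _ = [set x : d.-tuple (laurent F) |
    forall i, cell (a i) (tnth x i)]); last first.
  apply/seteqP; split=> x /=.
    by move=> [<- xU] i; split; [exact: xU|rewrite /= ffunE].
  move=> xa; split; last by move=> i; have [] := xa i.
  by apply/ffunP => i; rewrite ffunE; have [] := xa i.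
apply: (box (fun i => cell (a i))) => i.
  exact: measurable_cell.
exact: nu_cell.
Qed.

End TorusMeasure.

Section Torus.
Variables (R : realType) (F : finFieldType) (d : nat).
Variable P : probability (cylType F d) R.
Local Notation T := (d.-tuple (laurent F)).
Local Notation q := (#|F|%:R : R).
Hypothesis P_cell : forall N a, P (@Tr F d N @^-1` [set a]) = ((q ^- N) ^+ d)%:E.
Local Notation meas := (@measurable _ (cylType F d)).

Definition prob (A : set T) : R := fine (P A).
Local Notation pr := prob.

Lemma prE A : meas A -> P A = (pr A)%:E.
Proof. by move=> mA; rewrite fineK// fin_num_measure. Qed.

Lemma pr_ge0 A : 0 <= pr A.
Proof. by rewrite fine_ge0. Qed.

Lemma pr_le A B : meas A -> meas B -> A `<=` B -> pr A <= pr B.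
Proof.
move=> mA mB AB; rewrite -lee_fin -!prE//.
by apply: le_measure; rewrite ?inE.
Qed.

Lemma prT : pr setT = 1.
Proof. by rewrite /prob probability_setT. Qed.

Lemma pr0 : pr set0 = 0.
Proof. by rewrite /prob measure0. Qed.

Lemma pr_le1 A : meas A -> pr A <= 1.
Proof. by move=> mA; rewrite -prT; apply: pr_le. Qed.

Lemma pr_DI A B : meas A -> meas B -> pr A = pr (A `\` B) + pr (A `&` B).
Proof.
move=> mA mB; apply: EFin_inj; rewrite EFinD -!prE//; last 2 first.
- exact: measurableI.
- exact: measurableD.
exact: measureDI.
Qed.

Lemma pr_U A B : meas A -> meas B -> pr (A `|` B) <= pr A + pr B.
Proof.
move=> mA mB; rewrite -lee_fin EFinD -!prE//; last exact: measurableU.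
exact: measureU2.
Qed.

Lemma pr_fintype (I : finType) (D : {pred I}) (A : I -> set T) :
  (forall i, meas (A i)) -> trivIset setT A ->
  pr (\bigcup_(i in [set` D]) A i) = \sum_(i in D) pr (A i).
Proof.
move=> mA tA; apply: EFin_inj; rewrite -prE; last first.
  by apply: fin_bigcup_measurable => //; exact: finite_finset.
rewrite (measure_fintype P)// -sumEFin.
by apply: eq_bigr => i _; exact: prE.
Qed.

Lemma meas_level N W : level N W -> meas W.
Proof. by move=> lW; apply: sub_sigma_algebra; exists N. Qed.

Lemma q_gt1 : 1 < q.
Proof. by rewrite ltr1n card_finNzRing_gt1. Qed.

Lemma q_gt0 : 0 < q. Proof. exact: lt_trans ltr01 q_gt1. Qed.

Lemma pr_cell N a : pr (@Tr F d N @^-1` [set a]) = (q ^- N) ^+ d.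
Proof. by rewrite /prob P_cell. Qed.

Lemma trivIset_fibers (X : Type) (H : eqType) (V : set X) (phi : X -> H) :
  trivIset setT (fun h => V `&` phi @^-1` [set h]).
Proof.
apply/trivIsetP => h k _ _ hk; apply/seteqP; split=> // x [[_ /= xh] [_ /= xk]].
by move: hk; rewrite -xh xk eqxx.
Qed.

Lemma pr_fibers (H : finType) (phi : T -> H) (V : set T) : meas V ->
  (forall h, meas (phi @^-1` [set h])) ->
  pr V = \sum_(h : H) pr (V `&` phi @^-1` [set h]).
Proof.
move=> mV mphi; rewrite -(@pr_fintype _ predT (fun h => V `&` phi @^-1` [set h])).
- by congr pr; apply/seteqP; split=> [x Vx|x [h _ []]]//; exists (phi x).
- by move=> h; exact: measurableI.
- exact: trivIset_fibers.
Qed.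

Lemma pr_level N W : level N W ->
  pr W = #|[pred a | `[< W (@ofTr F d N a) >]]|%:R * (q ^- N) ^+ d.
Proof.
move=> lW; rewrite {1}(level_bigcup lW) pr_fintype.
- by under eq_bigr do rewrite pr_cell; rewrite sumr_const mulr_natl.
- by move=> a /=; apply: (@meas_level N); exact: level_Tr.
- have := @trivIset_fibers T _ setT (@Tr F d N).
  by congr (trivIset _ _); apply/funext => a; rewrite setTI.
Qed.

Definition tadd (x t : T) : T := [tuple tnth x i + tnth t i | i < d].

Lemma Tr_tadd N x t : Tr N (tadd x t) = Tr N x + Tr N t.
Proof. by apply/ffunP => i; rewrite !ffunE tnth_mktuple trD. Qed.

Lemma level_translate N W t : level N W -> level N [set x | W (tadd x t)].
Proof. by move=> lW x y xy /=; apply: lW; rewrite !Tr_tadd xy. Qed.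

Lemma pr_translate N W t : level N W -> pr [set x | W (tadd x t)] = pr W.
Proof.
move=> lW; rewrite (pr_level lW) (pr_level (@level_translate N W t lW)).
congr (_%:R * _); rewrite -!sum1_card [RHS](reindex_inj (addIr (Tr N t))).
apply: eq_bigl => a; rewrite !inE; apply: asbool_equiv_eq.
by split; apply: lW; rewrite Tr_tadd !Tr_ofTr.
Qed.

Lemma equidistribution (H : finType) (phi : T -> H) N (V : set T) :
  level N V -> (forall x y, Tr N x = Tr N y -> phi x = phi y) ->
  (forall h k, exists t, (forall x, V (tadd x t) <-> V x) /\
                         forall x, phi (tadd x t) = h <-> phi x = k) ->
  forall h, pr (V `&` phi @^-1` [set h]) = pr V / #|H|%:R.
Proof.
move=> lV lphi tr_ex h.
have lfib k : level N (V `&` phi @^-1` [set k]).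
  by apply: levelI => // x y xy /= <-; exact/esym/lphi.
have same k : pr (V `&` phi @^-1` [set k]) = pr (V `&` phi @^-1` [set h]).
  have [t [tV tphi]] := tr_ex h k.
  rewrite -(pr_translate t (lfib h)); congr pr; apply/seteqP; split=> x [Vx].
    by move=> /tphi xh; split; first exact/tV.
  by move=> /tphi xk; split; first exact/tV.
rewrite (@pr_fibers _ phi V (meas_level lV)).
  by under eq_bigr do rewrite same; rewrite sumr_const -[X in _ = X / _]mulr_natr mulfK//
    pnatr_eq0 -lt0n; apply/card_gt0P; exists h.
by move=> k; apply: (@meas_level N) => x y xy /= <-; exact/esym/lphi.
Qed.

End Torus.

(** * Ergodicity of the shears *)

Section Ergodicity.
Variables (R : realType) (F : finFieldType) (d : nat).
Variable P : probability (cylType F d) R.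
Local Notation T := (d.-tuple (laurent F)).
Local Notation q := (#|F|%:R : R).
Hypothesis P_cell : forall N a, P (@Tr F d N @^-1` [set a]) = ((q ^- N) ^+ d)%:E.
Local Notation meas := (@measurable _ (cylType F d)).
Local Notation pr := (prob P).
Implicit Types (A B W : set T).

Definition shear (i j : 'I_d) (N : nat) (x : T) : T :=
  [tuple if l == i then tnth x i + ('X^N)%:L * tnth x j else tnth x l | l < d].

Lemma tnth_shear i j N x l : tnth (shear i j N x) l =
  if l == i then tnth x i + ('X^N)%:L * tnth x j else tnth x l.
Proof. by rewrite tnth_mktuple. Qed.

Lemma tr_polyLXn n N (f g : laurent F) : tr (n + N) f = tr (n + N) g ->
  tr n (('X^N)%:L * f) = tr n (('X^N)%:L * g).
Proof.
move=> /tr_eqP fg; apply/tr_eqP => k kn; rewrite !coef_polyLXn_mul.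
by rewrite (_ : _ - _ = - (k + N).+1%:Z)%R; [apply: fg|]; lia.
Qed.

Lemma Tr_shear i j N n x y : Tr (n + N) x = Tr (n + N) y ->
  Tr n (shear i j N x) = Tr n (shear i j N y).
Proof.
move=> xy; have /TrP xyn := Tr_le (leq_addr N n) xy.
move/TrP in xy; apply/TrP => l; rewrite !tnth_shear; case: eqP => // _.
by rewrite !trD xyn (tr_polyLXn (xy j)).
Qed.

Lemma level_shear i j N n W : level n W -> level (n + N) (shear i j N @^-1` W).
Proof. by move=> lW x y /(Tr_shear i j) xy /=; exact: lW. Qed.

Lemma card_Tr n : #|{: {ffun 'I_d -> 'rV[F]_n}}|%:R = (q ^+ n) ^+ d.
Proof. by rewrite card_ffun card_mx card_ord mul1n !natrX. Qed.

(* Adding a vector with prescribed digits translates the preimages of the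
   cells into each other, so these preimages are equally likely. *)
Lemma pr_shear_cell i j N n (a : {ffun 'I_d -> 'rV[F]_n}) : i != j ->
  pr (shear i j N @^-1` (Tr n @^-1` [set a])) = pr (Tr n @^-1` [set a]).
Proof.
move=> ij; have := @equidistribution R F d P P_cell _ (Tr n \o shear i j N)
  (n + N)%N setT _ _ _ a.
rewrite setTI prT div1r => -> //; last 2 first.
- by move=> x y /(Tr_shear i j).
- move=> h k; exists [tuple if l == i then
    ofr ((h - k) i - tr n (('X^N)%:L * ofr ((h - k) j))) else ofr ((h - k) l) | l < d].
  split=> // x; set t := [tuple _ | _ < d].
  have -> : (Tr n \o shear i j N) (tadd x t) = (Tr n \o shear i j N) x + (h - k).
    apply/ffunP => l; rewrite !ffunE !tnth_shear.
    rewrite !tnth_mktuple eqxx [j == i]eq_sym (negbTE ij).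
    case: eqP => [->|_]; last by rewrite trD tr_ofr !ffunE.
    rewrite mulrDr !trD tr_ofr.
    set u := tr n (_ * ofr _).
    by rewrite addrACA subrK !ffunE.
  split=> [e|->]; last by rewrite addrCA subrr addr0.
  by rewrite -[LHS](addrK (h - k)) e opprB addrCA subrr addr0.
by rewrite card_Tr (pr_cell P_cell) -exprVn.
Qed.

Lemma meas_Tr n a : meas (@Tr F d n @^-1` [set a]).
Proof. by apply: (@meas_level F d n); exact: level_Tr. Qed.

Lemma pr_shear_level i j N n W : i != j -> level n W ->
  pr (shear i j N @^-1` W) = pr W.
Proof.
move=> ij lW; rewrite [X in _ = pr X](level_bigcup lW) [X in pr (_ @^-1` X)](level_bigcup lW).
rewrite preimage_bigcup.
have mS a : meas (shear i j N @^-1` (Tr n @^-1` [set a])).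
  by apply: (@meas_level F d (n + N)); apply: level_shear; exact: level_Tr.
have tT : trivIset setT (fun a => @Tr F d n @^-1` [set a]).
  have := @trivIset_fibers T _ setT (@Tr F d n).
  by congr (trivIset _ _); apply/funext => a; rewrite setTI.
have tS : trivIset setT (fun a => shear i j N @^-1` (@Tr F d n @^-1` [set a])).
  have := @trivIset_fibers T _ setT (@Tr F d n \o shear i j N).
  by congr (trivIset _ _); apply/funext => a; rewrite setTI.
rewrite (pr_fintype P _ mS tS) (pr_fintype P _ (@meas_Tr n) tT).
by apply: eq_bigr => a _; exact: pr_shear_cell.
Qed.

Lemma meas_shear i j N A : meas A -> meas (shear i j N @^-1` A).
Proof.
have : measurable_fun setT (shear i j N : cylType F d -> cylType F d).
  apply: (@measurability _ _ (cylType F d) (cylType F d) setT _ (@cylinder F d))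
    => // _ [W [n lW] <-].
  by rewrite setTI; apply: (@meas_level F d (n + N)); exact: level_shear.
by move=> mS mA; rewrite -[X in meas X]setTI; exact: mS.
Qed.

Lemma pr_shear i j N A : i != j -> meas A -> pr (shear i j N @^-1` A) = pr A.
Proof.
move=> ij mA; have mS : measurable_fun setT (shear i j N : cylType F d -> cylType F d).
  by move=> _ B mB; rewrite setTI; exact: meas_shear.
pose P' : {measure set (cylType F d) -> \bar R} :=
  measure_function_pushforward__canonical__measure_function_Measure P mS.
rewrite /prob -[P (_ @^-1` _)]/(P' A); congr fine; apply/esym.
apply: (@g_sigma_algebra_measure_unique _ R (cylType F d) (@cylinder F d) _
  (fun=> setT) _ _ P P') => //.
- exact: sub_sigma_algebra.
- by move=> _; exact: cylinderT.
- exact: bigcup_const.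
- exact: cylinderI.
- move=> W [n lW]; rewrite /P' /= /pushforward.
  rewrite !prE; last 2 first.
  + by apply: meas_shear; exact: meas_level lW.
  + exact: meas_level lW.
  by rewrite (pr_shear_level _ ij lW).
- by move=> _; exact: (le_lt_trans (probability_le1 P measurableT) (ltry 1)).
Qed.

End Ergodicity.

Section ZeroOne.
Variables (R : realType) (F : finFieldType) (d : nat).
Variable P : probability (cylType F d) R.
Local Notation T := (d.-tuple (laurent F)).
Local Notation q := (#|F|%:R : R).
Hypothesis P_cell : forall N a, P (@Tr F d N @^-1` [set a]) = ((q ^- N) ^+ d)%:E.
Local Notation meas := (@measurable _ (cylType F d)).
Local Notation pr := (prob P).
Implicit Types (A B W : set T).

Definition approximable A := forall e : R, 0 < e ->
  exists N W, level N W /\ pr (A `\` W) + pr (W `\` A) <= e.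

Lemma approximableC A : approximable A -> approximable (~` A).
Proof.
move=> aA e /aA[N [W [lW AW]]]; exists N, (~` W); split; first exact: levelC.
by rewrite !setDE !setCK addrC setIC [X in _ + pr X]setIC -!setDE.
Qed.

Lemma approximableU A B : meas A -> meas B -> approximable A -> approximable B ->
  approximable (A `|` B).
Proof.
move=> mA mB aA aB e e0; have e2 : 0 < e / 2 by lra.
have [N [W [lW AW]]] := aA _ e2; have [M [V [lV BV]]] := aB _ e2.
have {}lW := level_le (leq_maxl N M) lW; have {}lV := level_le (leq_maxr N M) lV.
have mW := meas_level lW; have mV := meas_level lV.
exists (maxn N M), (W `|` V); split; first exact: levelU.
have le1 : pr ((A `|` B) `\` (W `|` V)) <= pr (A `\` W) + pr (B `\` V).
  apply: le_trans (pr_U _ _ _); [apply: pr_le|..]; do ?[exact: measurableD].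
  - by apply: measurableD; exact: measurableU.
  - by apply: measurableU; exact: measurableD.
  - by move=> x [[Ax|Bx] /= nWV]; [left|right]; split => // ?; apply: nWV; [left|right].
have le2 : pr ((W `|` V) `\` (A `|` B)) <= pr (W `\` A) + pr (V `\` B).
  apply: le_trans (pr_U _ _ _); [apply: pr_le|..]; do ?[exact: measurableD].
  - by apply: measurableD; exact: measurableU.
  - by apply: measurableU; exact: measurableD.
  - by move=> x [[Ax|Bx] /= nWV]; [left|right]; split => // ?; apply: nWV; [left|right].
by lra.
Qed.

Lemma approximable_bigcup (A : (set T)^nat) : (forall k, meas (A k)) ->
  (forall k, approximable (A k)) -> approximable (\bigcup_k A k).
Proof.
move=> mA aA e e0; have e2 : 0 < e / 2 by lra.
have mU : meas (\bigcup_k A k) by exact: bigcup_measurable.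
pose B n := \big[setU/set0]_(k < n) A k.
have mB n : meas (B n) by apply: bigsetU_measurable => i _; exact: mA.
have aB n : approximable (B n).
  elim: n => [|n IH]; rewrite /B ?big_ord0 ?big_ord_recr /=.
    by move=> e' e'0; exists 0%N, set0; split=> //; rewrite setD0 (pr0 P) addr0 ltW.
  by apply: approximableU => //; exact: mB.
have BU n : B n `<=` \bigcup_k A k by rewrite /B; exact: bigsetU_bigcup.
have cB : P (B n) @[n --> \oo] --> P (\bigcup_k A k).
  rewrite (_ : \bigcup_k A k = \bigcup_k B k); last first.
    apply/seteqP; split=> [x [k _ Ax]|x [k _]]; last exact: BU.
    by exists k.+1 => //; rewrite /B big_ord_recr; right.
  apply: nondecreasing_cvg_mu => //; first exact: bigcup_measurable.
  by move=> n m nm; apply/subsetPset; exact: subset_bigsetU.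
have [n Bn] : exists n, pr (\bigcup_k A k) - e / 2 < pr (B n).
  apply: contrapT => nB.
  have : (P (\bigcup_k A k) <= (pr (\bigcup_k A k) - e / 2)%:E)%E.
    apply: (cvge_to_le cB); apply: nearW => n; rewrite (prE P)// lee_fin leNgt.
    by apply/negP => ?; apply: nB; exists n.
  by rewrite (prE P)// lee_fin; lra.
have [N [W [lW BW]]] := aB n _ e2; have mW := meas_level lW.
exists N, W; split => //.
have le1 : pr (\bigcup_k A k `\` W) <= pr (\bigcup_k A k `\` B n) + pr (B n `\` W).
  apply: le_trans (pr_U _ _ _); [apply: pr_le|..]; do ?[exact: measurableD].
  - by apply: measurableU; exact: measurableD.
  - by move=> x [Ux nWx]; have [Bx|Bx] := pselect (B n x); [right|left].
have le2 : pr (W `\` \bigcup_k A k) <= pr (W `\` B n).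
  apply: pr_le; do ?[exact: measurableD].
  by move=> x [Wx nU]; split => // /BU.
have := pr_DI P mU (mB n); rewrite setIC (setIidl (BU n)); lra.
Qed.

Lemma measurable_approximable A : meas A -> approximable A.
Proof.
move=> mA; suff [] : meas A /\ approximable A by [].
move: A mA; apply: smallest_sub => [|W [N lW]].
  split.
  - split; first exact: measurable0.
    by move=> e e0; exists 0%N, set0; split=> //; rewrite setD0 (pr0 P) addr0 ltW.
  - move=> A [mA aA]; rewrite setTD.
    by split; [exact: measurableC|exact: approximableC].
  - move=> A mA; split.
      by apply: bigcup_measurable => k _; have [] := mA k.
    by apply: approximable_bigcup => k; have [] := mA k.
split; first exact: meas_level lW.
by move=> e e0; exists N, W; split=> //; rewrite setDv (pr0 P) addr0 ltW.
Qed.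

Lemma pr_approx A W B : meas A -> meas W -> meas B ->
  `|pr (A `&` B) - pr (W `&` B)| <= pr (A `\` W) + pr (W `\` A).
Proof.
have half A1 A2 : meas A1 -> meas A2 -> meas B ->
    pr (A1 `&` B) <= pr (A2 `&` B) + pr (A1 `\` A2).
  move=> m1 m2 mB; apply: le_trans (pr_U _ _ _); [apply: pr_le|..].
  - exact: measurableI.
  - by apply: measurableU; [exact: measurableI|exact: measurableD].
  - by move=> x [x1 xB]; have [x2|x2] := pselect (A2 x); [left|right].
  - exact: measurableI.
  - exact: measurableD.
move=> mA mW mB; have := half _ _ mA mW mB; have := half _ _ mW mA mB.
have := pr_ge0 P (A `\` W); have := pr_ge0 P (W `\` A).
by move=> *; rewrite ler_norml; apply/andP; split; lra.
Qed.

End ZeroOne.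

Section ZeroOneLaw.
Variables (R : realType) (F : finFieldType) (d : nat).
Variable P : probability (cylType F d) R.
Local Notation T := (d.-tuple (laurent F)).
Local Notation q := (#|F|%:R : R).
Hypothesis P_cell : forall N a, P (@Tr F d N @^-1` [set a]) = ((q ^- N) ^+ d)%:E.
Local Notation meas := (@measurable _ (cylType F d)).
Local Notation pr := (prob P).
Implicit Types (A B W : set T).

(* The first n digits of x_i + X^N x_j involve the digits of x_j beyond the
   N-th one, on which an event of level N does not depend. *)
Lemma pr_mixing i j N n (V : set T) (a : 'rV[F]_n) : i != j -> level N V ->
  pr (V `&` [set x | tr n (tnth x i + ('X^N)%:L * tnth x j) = a]) = pr V * q ^- n.
Proof.
move=> ij lV; pose phi (x : T) := tr n (tnth x i + ('X^N)%:L * tnth x j).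
have lV' : level (n + N) V := level_le (leq_addl n N) lV.
rewrite (equidistribution P_cell (phi := phi) lV').
- by rewrite card_mx mul1n natrX.
- move=> x y xy; have /TrP xyn := Tr_le (leq_addr N n) xy; move/TrP in xy.
  by rewrite /phi !trD xyn (tr_polyLXn (xy j)).
- move=> h k; have [g gE] := divXn_ex N (ofr (h - k)).
  have XNg : ('X^N)%:L * g = ofr (h - k).
    by apply/laurentP/funext => m; rewrite coef_polyLXn_mul gE subrK.
  pose t : T := [tuple if l == j then g else 0 | l < d].
  exists t; split=> x.
    have xt : Tr N (tadd x t) = Tr N x.
      apply/TrP => l; rewrite !tnth_mktuple; case: eqP => _; last by rewrite addr0.
      rewrite trD [X in _ + X](_ : _ = 0) ?addr0//; apply/rowP => m; rewrite !mxE gE.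
      by apply: bnd_ofr; have := ltn_ord m; lia.
    by split; apply: lV; rewrite xt.
  have -> : phi (tadd x t) = phi x + (h - k).
    rewrite /phi !tnth_mktuple eqxx (negbTE ij) addr0 mulrDr XNg addrA.
    by rewrite [LHS]trD tr_ofr.
  split=> [e|->]; last by rewrite addrCA subrr addr0.
  by rewrite -[LHS](addrK (h - k)) e opprB addrCA subrr addr0.
Qed.

Definition partial_cell n (a : {ffun 'I_d -> 'rV[F]_n}) (J : {set 'I_d}) : set T :=
  [set x | forall l, l \in J -> tr n (tnth x l) = a l].

Lemma level_partial_cell n a J : level n (@partial_cell n a J).
Proof. by move=> x y /TrP xy xa l lJ; rewrite -xy xa. Qed.

Lemma qn_gt0 n : 0 < q ^- n :> R.
Proof. by rewrite invr_gt0 exprn_gt0// q_gt0. Qed.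

Lemma qn_le1 n : q ^- n <= 1 :> R.
Proof. by rewrite invf_le1 ?exprn_gt0 ?q_gt0// exprn_ege1// ltW// q_gt1. Qed.

Lemma pr_shear_invariant i j N A B : i != j -> meas A -> meas B ->
  A `<=` shear i j N @^-1` A ->
  pr (A `&` B) = pr (A `&` shear i j N @^-1` B).
Proof.
move=> ij mA mB AS; have mSA := meas_shear i j N mA; have mSB := meas_shear i j N mB.
rewrite -(pr_shear P_cell N ij); last exact: measurableI.
rewrite preimage_setI.
have := pr_DI P mSA mA; rewrite (pr_shear P_cell _ ij)// setIidr// => SA0.
apply/eqP; rewrite eq_le; apply/andP; split; last first.
  apply: pr_le; [exact: measurableI..|exact: setSI].
apply: le_trans (_ : pr (A `&` shear i j N @^-1` B) + pr (shear i j N @^-1` A `\` A) <= _).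
  apply: le_trans (pr_U _ _ _); [apply: pr_le|..];
    [exact: measurableI| | |exact: measurableI|exact: measurableD].
  - by apply: measurableU; [exact: measurableI|exact: measurableD].
  - by move=> x [SAx Bx]; have [Ax|nAx] := pselect (A x); [left|right].
by lra.
Qed.

Hypothesis d_ge2 : (2 <= d)%N.

Lemma other_index (i : 'I_d) : exists j, i != j.
Proof.
have d0 : (0 < d)%N by lia.
have [i0|i0] := eqVneq i (Ordinal d0); last by exists (Ordinal d0).
by exists (Ordinal d_ge2); rewrite i0.
Qed.

Lemma invariant_partial_cell A n a (i : 'I_d) (J : {set 'I_d}) : meas A ->
  (forall i j N, i != j -> A `<=` shear i j N @^-1` A) -> i \notin J ->
  pr (A `&` @partial_cell n a (i |: J)) = pr (A `&` partial_cell a J) * q ^- n.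
Proof.
move=> mA AS iJ; apply/eqP; rewrite -subr_eq0 -normr_le0; apply/ler_addgt0Pr => e e0.
rewrite add0r; have e2 : 0 < e / 2 by lra.
have [N0 [W [lW0 AW]]] := measurable_approximable P mA e2.
pose N := maxn N0 n; have lW : level N W := level_le (leq_maxl _ _) lW0.
have mW := meas_level lW.
have lJ K : level N (partial_cell a K) := level_le (leq_maxr _ _) (@level_partial_cell n a K).
have [j ij] := other_index i.
have mC K : meas (partial_cell a K) by exact: meas_level (lJ K).
have mSC := meas_shear i j N (mC (i |: J)).
rewrite (pr_shear_invariant ij mA (mC _) (AS _ _ N ij)).
have WS : pr (W `&` shear i j N @^-1` partial_cell a (i |: J)) =
    pr (W `&` partial_cell a J) * q ^- n.
  rewrite -(pr_mixing (a i) ij (levelI lW (lJ J))) -setIA; congr (pr (_ `&` _)).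
  apply/seteqP; split=> x /=.
    move=> xa; split=> [l lJ'|]; last first.
      by have := xa i; rewrite tnth_shear eqxx setU11; exact.
    have := xa l; rewrite tnth_shear in_setU1 lJ' orbT => /(_ isT).
    by case: eqP lJ' iJ => // -> ->.
  move=> [xJ xi] l; rewrite tnth_shear in_setU1.
  by case: eqP => [-> _ //|_ /= lJ']; exact: xJ.
have h1 := pr_approx P mA mW mSC.
have h2 := pr_approx P mA mW (mC J).
rewrite WS in h1; set u := pr (A `&` _); set v := pr (A `&` _) in h2 *.
have h3 : `|pr (W `&` partial_cell a J) * q ^- n - v * q ^- n| <= e / 2.
  rewrite -mulrBl normrM (gtr0_norm (qn_gt0 n)) distrC.
  by apply: le_trans (ler_pM _ _ (le_trans h2 AW) (qn_le1 n)) _;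
    rewrite ?normr_ge0 ?mulr1// ltW ?qn_gt0.
rewrite -/u in h1; have := ler_distD (pr (W `&` partial_cell a J) * q ^- n) u (v * q ^- n).
by move/le_trans; apply; have := le_trans h1 AW; lra.
Qed.

Lemma invariant_cell A n a : meas A ->
  (forall i j N, i != j -> A `<=` shear i j N @^-1` A) ->
  pr (A `&` (@Tr F d n @^-1` [set a])) = pr A * (q ^- n) ^+ d.
Proof.
move=> mA AS.
have cellJ k (J : {set 'I_d}) : #|J| = k ->
    pr (A `&` partial_cell a J) = pr A * (q ^- n) ^+ k.
  elim: k J => [|k IH] J Jk.
    rewrite expr0 mulr1; congr pr; rewrite setIidl// => x _ l.
    by rewrite (cards0_eq Jk) inE.
  have [i iJ] : exists i, i \in J by apply/card_gt0P; rewrite Jk.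
  rewrite -(finset.setD1K iJ) invariant_partial_cell ?inE ?eqxx//.
  by rewrite IH ?exprSr ?mulrA//; move: Jk; rewrite (cardsD1 i) iJ => -[].
have cT : #|[set: 'I_d]%SET| = d by rewrite cardsT card_ord.
rewrite -(cellJ _ _ cT); congr (pr (_ `&` _)).
apply/seteqP; split=> x /=; first by move=> <- l _; rewrite ffunE.
by move=> xa; apply/ffunP => l; rewrite ffunE xa ?inE.
Qed.

Lemma invariant_level A N W : meas A ->
  (forall i j N, i != j -> A `<=` shear i j N @^-1` A) -> level N W ->
  pr (A `&` W) = pr A * pr W.
Proof.
move=> mA AS lW; rewrite (level_bigcup lW) setI_bigcupr.
have mT a : meas (@Tr F d N @^-1` [set a]) by exact: meas_Tr.
have mAT a : meas (A `&` @Tr F d N @^-1` [set a]) by exact: measurableI.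
have tT := @trivIset_fibers T _ setT (@Tr F d N).
have {}tT : trivIset setT (fun a => @Tr F d N @^-1` [set a]).
  by move: tT; congr (trivIset _ _); apply/funext => a; rewrite setTI.
rewrite (pr_fintype P _ mT tT) (pr_fintype P _ mAT (@trivIset_fibers T _ A (@Tr F d N))).
rewrite mulr_sumr; apply: eq_bigr => a _.
by rewrite invariant_cell// (pr_cell P_cell).
Qed.

Lemma zero_one A : meas A ->
  (forall i j N, i != j -> A `<=` shear i j N @^-1` A) ->
  pr A = 0 \/ pr A = 1.
Proof.
move=> mA AS; suff : pr A = pr A * pr A.
  move=> /eqP; rewrite -subr_eq0 -{1}[pr A]mulr1 -mulrBr mulf_eq0 subr_eq0.
  by move=> /orP[/eqP ->|/eqP <-]; [left|right].
apply/eqP; rewrite -subr_eq0 -normr_le0; apply/ler_addgt0Pr => e e0.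
rewrite add0r; have e2 : 0 < e / 2 by lra.
have [N [W [lW AW]]] := measurable_approximable P mA e2.
have mW := meas_level lW.
have h1 := pr_approx P mA mW mA.
have := pr_approx P mA mW (@measurableT _ (cylType F d)); rewrite !setIT => h2.
have h3 : `|pr A * pr W - pr A * pr A| <= e / 2.
  rewrite -mulrBr normrM distrC ger0_norm ?pr_ge0//.
  by apply: le_trans (ler_pM _ _ (pr_le1 P mA) (le_trans h2 AW)) _;
    rewrite ?normr_ge0 ?mul1r// pr_ge0.
move: h1; rewrite setIid setIC (invariant_level mA AS lW) => h1.
have := ler_distD (pr A * pr W) (pr A) (pr A * pr A).
by move/le_trans; apply; have := le_trans h1 AW; lra.
Qed.

End ZeroOneLaw.

(** * Counting reduced fractions *)

Section Numerators.
Variables (F : finFieldType) (d : nat).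
Implicit Types (Q g : {poly F}).
Local Notation q := #|F|.

Definition numer m (a : {ffun 'I_d -> 'rV[F]_m}) : d.-tuple {poly F} :=
  [tuple rVpoly (a i) | i < d].

Lemma tnth_numer m (a : {ffun 'I_d -> 'rV[F]_m}) i : tnth (numer a) i = rVpoly (a i).
Proof. by rewrite tnth_mktuple. Qed.

Lemma size_numer m (a : {ffun 'I_d -> 'rV[F]_m}) i : (size (tnth (numer a) i) <= m)%N.
Proof. by rewrite tnth_numer; exact: size_poly. Qed.

Lemma numer_ex m (p : d.-tuple {poly F}) :
  (forall i, (size (tnth p i) <= m)%N) -> exists a, p = @numer m a.
Proof.
move=> pm; exists [ffun i => poly_rV (tnth p i)]; apply: eq_from_tnth => i.
by rewrite tnth_numer ffunE poly_rV_K.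
Qed.

Lemma dvdp_biggcd (r : seq 'I_d) (p : 'I_d -> {poly F}) g :
  (g %| \big[@gcdp F/0]_(i <- r) p i) = all (fun i => g %| p i) r.
Proof.
by elim: r => [|i r IH]; rewrite ?big_nil ?dvdp0// big_cons dvdp_gcd IH.
Qed.

Lemma numeratorsP Q (p : d.-tuple {poly F}) : Q != 0 ->
  numerators Q p <-> (forall i, (size (tnth p i) < size Q)%N) /\
    (forall g, (forall i, g %| tnth p i) -> g %| Q -> size g = 1%N).
Proof.
move=> Q0; rewrite /numerators /=; split=> -[pQ b]; split=> //.
  move=> g gp gQ; move/coprimepP: b => /(_ g); rewrite dvdp_biggcd gQ -size_poly_eq1.
  by move=> h; apply/eqP/h => //; apply/allP => i _.
apply/coprimepP => g; rewrite dvdp_biggcd => /allP gp gQ; rewrite -size_poly_eq1.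
by apply/eqP/b => // i; apply: gp; rewrite mem_index_enum.
Qed.

Definition primitive Q : pred {ffun 'I_d -> 'rV[F]_(size Q).-1} :=
  [pred a | `[< numerators Q (numer a) >]].

Definition all_dvd m g : pred {ffun 'I_d -> 'rV[F]_m} :=
  [pred a : {ffun 'I_d -> 'rV[F]_m} | [forall i, g %| rVpoly (a i)]].

Lemma card_all_dvd m g : g != 0 -> (#|@all_dvd m g| <= (q ^ (m - (size g).-1)) ^ d)%N.
Proof.
move=> g0; pose f (a : {ffun 'I_d -> 'rV[F]_m}) : {ffun 'I_d -> 'rV[F]_(m - (size g).-1)} :=
  [ffun i => poly_rV (rVpoly (a i) %/ g)].
have -> : ((q ^ (m - (size g).-1)) ^ d)%N = #|{: {ffun 'I_d -> 'rV[F]_(m - (size g).-1)}}|.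
  by rewrite card_ffun card_mx mul1n card_ord.
apply: (leq_card_in f) => a b /forallP ga /forallP gb /ffunP ab; apply/ffunP => i.
have sz c : (size (rVpoly (c : 'rV[F]_m) %/ g)%R <= m - (size g).-1)%N.
  by rewrite size_divp// leq_sub2r// size_poly.
have := ab i; rewrite !ffunE => /(congr1 rVpoly); rewrite !poly_rV_K// => e.
by apply: (can_inj rVpolyK); rewrite -(divpK (ga i)) e divpK.
Qed.

Definition low_divisor n (v : 'rV[F]_n.+1) : {poly F} := 'X^(n.+1) + rVpoly v.

Lemma size_low_divisor n (v : 'rV[F]_n.+1) : size (low_divisor v) = n.+2.
Proof. by rewrite size_polyDl size_polyXn// ltnS size_poly. Qed.

Definition nz_const n : pred 'rV[F]_n.+1 := [pred v : 'rV[F]_n.+1 | v 0 0 != 0].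

Lemma card_low_divisors n :
  (#|@nz_const n| <= (q - 1) * q ^ n)%N.
Proof.
pose f (v : 'rV[F]_n.+1) : {c : F | c != 0} * 'rV[F]_n :=
  (insubd (exist _ 1 (oner_neq0 F)) (v 0 0), \row_j v 0 (lift ord0 j)).
have -> : ((q - 1) * q ^ n)%N = #|{: {c : F | c != 0} * 'rV[F]_n}|.
  rewrite card_prod card_mx mul1n card_sig; congr (_ * _)%N.
  by rewrite subn1 -(cardC1 (0 : F)); apply/esym/eq_card.
apply: (leq_card_in f) => u v; rewrite !inE => u0 v0 [] /(congr1 val).
rewrite !val_insubd u0 v0 => e /rowP uv; apply/rowP => j.
by have [k ->|->//] := unliftP ord0 j; have := uv k; rewrite !mxE.
Qed.

(* A nonconstant common divisor can be taken to be X or to be monic with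
   nonzero constant coefficient; the latter restriction is what makes the
   union bound below 1 even for q = d = 2. *)
Lemma not_primitive_dvd Q (a : {ffun 'I_d -> 'rV[F]_(size Q).-1}) : Q != 0 ->
  ~~ primitive a -> (1 < size Q)%N /\ (all_dvd 'X a \/
    exists n : 'I_(size Q).-1, exists2 v : 'rV[F]_n.+1, v 0 0 != 0 &
      all_dvd (low_divisor v) a).
Proof.
move=> Q0 /asboolPn na.
have [g [ga gQ g1]] : exists g, [/\ forall i, g %| rVpoly (a i), g %| Q & size g <> 1%N].
  apply: contrapT => ng; apply: na; apply/numeratorsP => //; split=> [i|g ga gQ].
    by rewrite (leq_ltn_trans (size_numer a i))// ltn_predL size_poly_gt0.
  apply: contrapT => g1; apply: ng; exists g; split=> // i.
  by have := ga i; rewrite tnth_numer.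
have g0 : g != 0 by apply: contraTneq gQ => ->; rewrite dvd0p.
have gs : (1 < size g)%N by have := g0; rewrite -size_poly_gt0; lia.
have gQs : (size g <= size Q)%N := dvdp_leq Q0 gQ.
split; first exact: leq_trans gs gQs.
have [Xg|Xg] := boolP ('X %| g).
  by left; apply/forallP => i; exact: dvdp_trans Xg (ga i).
have [s sg] : exists s, size g = s.+2 by exists (size g - 2)%N; lia.
right; pose h := (lead_coef g)^-1 *: g.
have lg : (lead_coef g)^-1 != 0 by rewrite invr_eq0 lead_coef_eq0.
have sh : size h = s.+2 by rewrite size_scale.
have hm : h`_s.+1 = 1.
  rewrite coefZ (_ : s.+1 = (size g).-1); last by rewrite sg.
  by rewrite -/(lead_coef g) mulVf// lead_coef_eq0.
have nlt : (s < (size Q).-1)%N by lia.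
exists (Ordinal nlt) => /=; exists (poly_rV (take_poly s.+1 h)).
  rewrite mxE coef_take_poly /= coefZ mulf_neq0//.
  by apply: contra Xg; rewrite -horner_coef0 -[_ == 0]/(root g 0) -dvdp_XsubCl polyC0 subr0.
apply/forallP => i; rewrite (_ : low_divisor _ = h) ?dvdpZl//.
rewrite /low_divisor poly_rV_K ?size_take_poly//.
apply/polyP => k; rewrite coefD coefXn coef_take_poly.
have [->|kn] := eqVneq k s.+1; first by rewrite ltnn addr0 hm.
case: ltnP => kn'; rewrite add0r// nth_default// sh.
by move: kn kn' => /eqP; lia.
Qed.

Lemma card_not_primitive Q : Q != 0 ->
  (#|[predC @primitive Q]| <= (1 < size Q) * (q ^ ((size Q).-1 - 1)) ^ d +
    \sum_(n < (size Q).-1) ((q - 1) * q ^ n) * (q ^ ((size Q).-1 - n.+1)) ^ d)%N.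
Proof.
move=> Q0; have [sQ|sQ] := ltnP 1 (size Q); last first.
  rewrite (eq_card0 (A := [predC @primitive Q]))// => a.
  by apply/negbTE/negP => na; have [] := not_primitive_dvd Q0 na; rewrite ltnNge sQ.
rewrite mul1n; set m := (size Q).-1.
apply: (@leq_trans (#|@all_dvd m 'X| +
    \sum_(n < m) \sum_(v : 'rV[F]_n.+1 | nz_const v) #|@all_dvd m (low_divisor v)|)).
  rewrite -!sum1_card; under [X in (_ <= _ + X)%N]eq_bigr => n _.
    under eq_bigr do rewrite -sum1_card big_mkcond /=.
    rewrite exchange_big /=; over.
  rewrite exchange_big /= [X in (_ <= X + _)%N]big_mkcond -big_split /= big_mkcond /=.
  apply: leq_sum => a _; case: ifP => // na.
  have [_ [aX|[n [v v0 av]]]] := not_primitive_dvd Q0 na; first by rewrite [_ \in _]aX.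
  rewrite (bigD1 n)//= (bigD1 v)//= [a \in all_dvd (low_divisor v)]av.
  by rewrite -addnA addnCA leq_addr.
apply: leq_add.
  by rewrite (leq_trans (card_all_dvd _ _)) ?polyX_eq0// size_polyX.
apply: leq_sum => n _; apply: leq_trans (_ : \sum_(v : 'rV[F]_n.+1 | nz_const v)
  (q ^ (m - n.+1)) ^ d <= _)%N.
  apply: leq_sum => v v0; apply: leq_trans (card_all_dvd _ _) _.
    by rewrite -size_poly_gt0 size_low_divisor.
  by rewrite size_low_divisor.
by rewrite sum_nat_const leq_mul2r card_low_divisors orbT.
Qed.

End Numerators.

Lemma card_primitive (R : realType) (F : finFieldType) d (Q : {poly F}) :
  (2 <= d)%N -> Q != 0 ->
  ((#|F| ^ (size Q).-1) ^ d)%:R / 4 <= #|@primitive F d Q|%:R :> R.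
Proof.
move=> d2 Q0; set m := (size Q).-1.
have q1 : 2 <= #|F|%:R :> R by rewrite ler_nat card_finNzRing_gt1.
have q0 : #|F|%:R != 0 :> R by rewrite gt_eqF//; lra.
pose x : R := #|F|%:R^-1; have xq : x * #|F|%:R = 1 by rewrite mulVf.
have x0 : 0 < x by rewrite invr_gt0; lra.
have x2 : x <= 1 / 2 by rewrite div1r lef_pV2 ?posrE; lra.
set M : R := ((#|F| ^ m) ^ d)%:R; have M0 : 0 <= M by rewrite ler0n.
have total : #|@primitive F d Q|%:R + #|[predC @primitive F d Q]|%:R = M.
  by rewrite -natrD cardC card_ffun card_mx mul1n card_ord.
have pow n : (n <= m)%N -> ((#|F| ^ (m - n)) ^ d)%:R <= M * (x ^+ n) ^+ 2.
  move=> nm; have -> : M = ((#|F| ^ (m - n)) ^ d)%:R * ((#|F| ^ n) ^ d)%:R.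
    by rewrite -natrM -expnMn -expnD subnK.
  have xn : x ^+ n * (#|F| ^ n)%:R = 1 by rewrite natrX -exprMn xq expr1n.
  rewrite -mulrA ler_peMr ?ler0n// natrX.
  apply: (@le_trans _ _ ((#|F| ^ n)%:R ^+ d * (x ^+ n) ^+ d)).
    by rewrite mulrC -exprMn xn expr1n.
  by rewrite ler_wpM2l ?exprn_ge0 ?ler0n// ler_wiXn2l ?exprn_ge0 ?exprn_ile1 1?ltW//; lra.
have geo k : \sum_(n < k) ((#|F|%:R - 1) * #|F|%:R ^+ n) * (x ^+ n.+1) ^+ 2 = x - x ^+ k.+1.
  elim: k => [|k IH]; first by rewrite big_ord0 expr1 subrr.
  rewrite big_ord_recr /= IH.
  have e : x ^+ k * #|F|%:R ^+ k = 1 by rewrite -exprMn xq expr1n.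
  rewrite expr2 !exprS -!exprS.
  rewrite (_ : _ * _ * (_ * _) = (x ^+ k * #|F|%:R ^+ k) * x ^+ k * x * (x * #|F|%:R - x)).
    by rewrite e xq !exprS; ring.
  by rewrite !exprS; ring.
have := card_not_primitive d Q0; rewrite -/m.
have [m0|m0] := posnP m.
  rewrite (_ : (1 < size Q)%N = false); last by rewrite /m in m0; lia.
  rewrite big1; last by move=> [n nm] _; exfalso; move: nm; rewrite -/m m0.
  rewrite leqn0 => /eqP c0; rewrite c0 addr0 in total.
  by rewrite total; lra.
rewrite (_ : (1 < size Q)%N = true); last by rewrite /m in m0; lia.
rewrite mul1n -(ler_nat R) natrD natr_sum => h.
have h1 := pow 1%N m0; rewrite expr1 in h1.
have h2 : \sum_(n < m) (((#|F| - 1) * #|F| ^ n) * (#|F| ^ (m - n.+1)) ^ d)%:R <= M * x.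
  apply: (@le_trans _ _ (M * (x - x ^+ m.+1))); last first.
    by rewrite ler_wpM2l// gerBl exprn_ge0// ltW.
  rewrite -geo mulr_sumr; apply: ler_sum => n _.
  rewrite natrM mulrCA natrM natrB ?natrX; last by rewrite (leq_trans _ (card_finNzRing_gt1 F)).
  rewrite ler_wpM2l//; first by apply: mulr_ge0; [lra|apply: exprn_ge0; lra].
  by rewrite -!natrX; apply: pow; rewrite ltn_ord.
have : M * x <= M * (1 / 2) by rewrite ler_wpM2l.
have : M * x ^+ 2 <= M * (1 / 4) by rewrite ler_wpM2l//; nra.
by lra.
Qed.

Section Fractions.
Variables (F : finFieldType) (d : nat).
Implicit Types (Q p : {poly F}).
Local Notation q := #|F|.
Local Notation T := (d.-tuple (laurent F)).

Lemma pred_size_mul p p' : p != 0 -> p' != 0 ->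
  ((size (p * p')%R).-1 = (size p).-1 + (size p').-1)%N.
Proof.
move=> p0 p0'; rewrite size_mul//; move: p0 p0'; rewrite -!size_poly_gt0.
by move: (size p) (size p') => a b; lia.
Qed.

Lemma leq_size_quotient p p' n : p != 0 -> p' != 0 ->
  (size (p * p')%R <= n)%N -> (size p <= n - (size p').-1)%N.
Proof.
move=> p0 p0'; rewrite size_mul//; move: p0 p0'; rewrite -!size_poly_gt0.
by move: (size p) (size p') => a b; lia.
Qed.

Lemma cross_exponent (a b c n : nat) :
  (0 < a + b - (a + n) - c -> c + (a + b - (a + n) - c) + n = b)%N.
Proof. by lia. Qed.

Definition fracs Q (p : d.-tuple {poly F}) : T :=
  [tuple (tnth p i)%:L / Q%:L | i < d].

Lemma polyL_monic_neq0 Q : Q \is monic -> Q%:L != 0.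
Proof. by move=> /monic_neq0; rewrite polyL_eq0. Qed.

Lemma bnd_frac Q p : Q \is monic -> (size p < size Q)%N -> bnd (p%:L / Q%:L) (-1).
Proof.
move=> Qm pQ; apply/(bndM_monic _ _ Qm); rewrite divfK ?polyL_monic_neq0// addrC.
by apply/bnd_polyL; rewrite -ltnS (leq_trans pQ)// leqSpred.
Qed.

Lemma size_cross Q Q' p p' k : Q \is monic -> Q' \is monic ->
  (size p < size Q)%N -> (size p' < size Q')%N ->
  tr k (p%:L / Q%:L) = tr k (p'%:L / Q'%:L) ->
  (size (p * Q' - p' * Q)%R <= (size Q).-1 + (size Q').-1 - k)%N.
Proof.
move=> Qm Qm' pQ pQ' /(tr_bnd _ (bnd_frac Qm pQ) (bnd_frac Qm' pQ')) pp'.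
have Q0 := polyL_monic_neq0 Qm; have Q0' := polyL_monic_neq0 Qm'.
have QQm : Q * Q' \is monic by rewrite monicMl.
have := proj2 (bndM_monic _ _ QQm) pp'.
rewrite size_monicM ?monic_neq0// polyLM.
rewrite (_ : (_ - _) * _ = (p * Q' - p' * Q)%:L); last first.
  by rewrite polyLB !polyLM; field; rewrite Q0 Q0'.
move=> b; apply/bnd_polyL; apply: bnd_le b _.
have sQ : (0 < size Q)%N by rewrite size_poly_gt0 monic_neq0.
have sQ' : (0 < size Q')%N by rewrite size_poly_gt0 monic_neq0.
move: (size Q) (size Q') sQ sQ' => m m'; lia.
Qed.

Lemma fracs_inj Q k (p p' : d.-tuple {poly F}) : Q \is monic ->
  ((size Q).-1 <= k)%N -> (forall i, (size (tnth p i) < size Q)%N) ->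
  (forall i, (size (tnth p' i) < size Q)%N) ->
  Tr k (fracs Q p) = Tr k (fracs Q p') -> p = p'.
Proof.
move=> Qm Qk sp sp' /TrP pp'; apply: eq_from_tnth => i.
have := pp' i; rewrite !tnth_mktuple => /(size_cross Qm Qm (sp i) (sp' i)).
rewrite -mulrBl => h; apply/eqP; rewrite -subr_eq0; apply: contraT => n0.
have sQ : (0 < size Q)%N by rewrite size_poly_gt0 monic_neq0.
move: h; rewrite size_Mmonic//; move: n0; rewrite -size_poly_gt0.
by move: (size _) (size Q) sQ Qk => s m; lia.
Qed.

(* Writing D = gcd (Q, Q'), the vector (p_i Q' - p'_i Q) / D is nonzero because
   both fractions are reduced, and it determines p mod Q / D, hence the pair
   (p, p') once p %/ (Q / D) is also known. *)
Lemma card_close_fractions Q Q' l : Q \is monic -> Q' \is monic -> Q != Q' ->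
  (#|[pred a' : {ffun 'I_d -> 'rV[F]_(size Q').-1} | @primitive F d Q' a' &&
     [exists a, @primitive F d Q a &&
       (Tr ((size Q).-1 + l) (fracs Q (numer a)) ==
        Tr ((size Q).-1 + l) (fracs Q' (numer a')))]]| * (q ^ l) ^ d
    <= (q ^ (size Q').-1) ^ d)%N.
Proof.
move=> Qm Qm' QQ'; set k := ((size Q).-1 + l)%N.
have Q0 := monic_neq0 Qm; have Q0' := monic_neq0 Qm'.
pose close (a : {ffun 'I_d -> 'rV[F]_(size Q).-1})
  (a' : {ffun 'I_d -> 'rV[F]_(size Q').-1}) :=
  Tr k (fracs Q (numer a)) == Tr k (fracs Q' (numer a')).
set S := [pred a' | _].
have [S0|/pred0Pn[b' /andP[pb' /existsP[b /andP[pb bb']]]]] := eqVneq #|S| 0%N.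
  by rewrite S0.
pose D := gcdp Q Q'; pose A := Q %/ D; pose B := Q' %/ D.
have D0 : D != 0 by rewrite gcdp_eq0 negb_and Q0.
have DQ : A * D = Q by rewrite divpK ?dvdp_gcdl.
have DQ' : B * D = Q' by rewrite divpK ?dvdp_gcdr.
have A0 : A != 0 by apply: contraNneq Q0 => e; rewrite -DQ e mul0r.
have AB : coprimep A B by rewrite coprimep_div_gcd// Q0.
have sA : ((size A).-1 + (size D).-1 = (size Q).-1)%N.
  by rewrite -DQ pred_size_mul.
have sz (a : {ffun 'I_d -> 'rV[F]_(size Q).-1}) i : (size (tnth (numer a) i) < size Q)%N.
  by rewrite (leq_ltn_trans (size_numer a i))// ltn_predL size_poly_gt0.
have sz' (a : {ffun 'I_d -> 'rV[F]_(size Q').-1}) i : (size (tnth (numer a) i) < size Q')%N.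
  by rewrite (leq_ltn_trans (size_numer a i))// ltn_predL size_poly_gt0.
pose t (a : {ffun 'I_d -> 'rV[F]_(size Q).-1}) (a' : {ffun 'I_d -> 'rV[F]_(size Q').-1}) i :=
  rVpoly (a i) * B - rVpoly (a' i) * A.
have tD a a' i : t a a' i * D = rVpoly (a i) * Q' - rVpoly (a' i) * Q.
  by rewrite /t mulrBl -!mulrA DQ DQ'.
pose e := ((size Q).-1 + (size Q').-1 - k - (size D).-1)%N.
have st a a' i : close a a' -> (size (t a a' i) <= e)%N.
  move=> /eqP/TrP/(_ i); rewrite !tnth_mktuple.
  have := sz a i; have := sz' a' i; rewrite !tnth_numer => s's ss.
  move=> /(size_cross Qm Qm' ss s's); rewrite -tD => h.
  have [->|t0] := eqVneq (t a a' i) 0; first by rewrite size_poly0.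
  exact: leq_size_quotient.
have e_gt0 : (0 < e)%N.
  rewrite lt0n; apply: contra QQ' => /eqP e0.
  have t0 i : t b b' i = 0.
    by apply/eqP; rewrite -size_poly_leq0; have := st _ _ i bb'; rewrite e0.
  have t0' i : rVpoly (b i) * B = rVpoly (b' i) * A.
    by apply/eqP; rewrite -subr_eq0; apply/eqP/t0.
  have sA1 : size A = 1%N.
    have /asboolP/(numeratorsP _ Q0)[_ /(_ A)] := pb.
    apply; last by rewrite -DQ dvdp_mulr.
    by move=> i; rewrite tnth_numer -(Gauss_dvdpl _ AB) t0' dvdp_mull.
  have sB1 : size B = 1%N.
    have /asboolP/(numeratorsP _ Q0')[_ /(_ B)] := pb'.
    apply; last by rewrite -DQ' dvdp_mulr.
    by move=> i; rewrite tnth_numer -(Gauss_dvdpl _ (_ : coprimep B A))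
      -?t0' ?dvdp_mull// coprimep_sym.
  rewrite -(eqp_monic Qm Qm').
  apply: (@eqp_trans _ D); first by rewrite -DQ -{2}[D]mul1r eqp_mul2r// -size_poly_eq1 sA1.
  by rewrite eqp_sym -DQ' -{2}[D]mul1r eqp_mul2r// -size_poly_eq1 sB1.
pose S2 := [set z : {ffun 'I_d -> 'rV[F]_(size Q).-1} * {ffun 'I_d -> 'rV[F]_(size Q').-1} |
  close z.1 z.2]%SET.
have SS2 : (#|S| <= #|S2|)%N.
  apply: leq_trans (leq_imset_card snd S2); apply: subset_leq_card.
  apply/fintype.subsetP => a' /andP[_ /existsP[a /andP[_ aa']]].
  by apply/imsetP; exists (a, a'); rewrite ?inE.
pose f (z : {ffun 'I_d -> 'rV[F]_(size Q).-1} * {ffun 'I_d -> 'rV[F]_(size Q').-1}) :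
    {ffun 'I_d -> 'rV[F]_(size D).-1 * 'rV[F]_e} :=
  [ffun i => (poly_rV (rVpoly (z.1 i) %/ A), poly_rV (t z.1 z.2 i))].
have S2f : (#|S2| <= (q ^ (size D).-1 * q ^ e) ^ d)%N.
  have -> : ((q ^ (size D).-1 * q ^ e) ^ d)%N =
      #|{: {ffun 'I_d -> 'rV[F]_(size D).-1 * 'rV[F]_e}}|.
    by rewrite card_ffun card_prod !card_mx !mul1n card_ord.
  apply: (leq_card_in f) => -[a1 a1'] [a2 a2']; rewrite !inE /= => c1 c2 /ffunP f12.
  have arith s m a c : (s < m -> a.-1 + c.-1 = m.-1 -> s - a.-1 <= c.-1)%N.
    by move=> sm ac; rewrite leq_subLR ac -ltnS (leq_trans sm)// leqSpred.
  have dA i : rVpoly (a1 i) %/ A = rVpoly (a2 i) %/ A.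
    have := f12 i; rewrite !ffunE => -[/(congr1 rVpoly)]; rewrite !poly_rV_K//.
    - rewrite size_divp//; have := sz a2 i; rewrite tnth_numer => /arith; apply.
      exact: sA.
    - rewrite size_divp//; have := sz a1 i; rewrite tnth_numer => /arith; apply.
      exact: sA.
  have tt i : t a1 a1' i = t a2 a2' i.
    have := f12 i; rewrite !ffunE => -[_ /(congr1 rVpoly)].
    by rewrite !poly_rV_K ?st.
  have e1 i : (rVpoly (a1 i) - rVpoly (a2 i)) * B = (rVpoly (a1' i) - rVpoly (a2' i)) * A.
    rewrite !mulrBl; apply/eqP; rewrite -subr_eq0 opprB [X in _ + X]addrC addrACA.
    by rewrite [X in _ + X]addrC (tt i : _ - _ = _) /t addrA subrK subrr.
  have aa i : rVpoly (a1 i) = rVpoly (a2 i).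
    apply/eqP; rewrite -subr_eq0.
    have : A %| rVpoly (a1 i) - rVpoly (a2 i).
      by rewrite -(Gauss_dvdpl _ AB) e1 dvdp_mull.
    rewrite /dvdp modpD modpN => /eqP/subr0_eq m12.
    by rewrite (divp_eq (rVpoly (a1 i)) A) (divp_eq (rVpoly (a2 i)) A) dA m12 subrr.
  congr pair; apply/ffunP => i; apply: (can_inj rVpolyK); first exact: aa.
  have := e1 i; rewrite aa subrr mul0r => /esym/eqP.
  by rewrite mulf_eq0 (negbTE A0) orbF subr_eq0 => /eqP.
apply: leq_trans (leq_mul (leq_trans SS2 S2f) (leqnn _)) _.
rewrite -expnD -expnMn -expnD.
by rewrite cross_exponent.
Qed.

End Fractions.

(** * Quasi-independence and the limsup set *)

Section Events.
Variables (R : realType) (F : finFieldType) (d : nat).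
Variable P : probability (cylType F d) R.
Local Notation T := (d.-tuple (laurent F)).
Local Notation q := (#|F|%:R : R).
Hypothesis P_cell : forall N a, P (@Tr F d N @^-1` [set a]) = ((q ^- N) ^+ d)%:E.
Hypothesis d_ge2 : (2 <= d)%N.
Local Notation meas := (@measurable _ (cylType F d)).
Local Notation pr := (prob P).
Implicit Types (Q : {poly F}).

Definition wt (l : nat) : R := (q ^- l) ^+ d.

Definition near_fracs Q k : set T :=
  [set x | exists2 p, numerators Q p & Tr k x = Tr k (fracs Q p)].

Definition frac_cell Q k (a : {ffun 'I_d -> 'rV[F]_(size Q).-1}) : set T :=
  Tr k @^-1` [set Tr k (fracs Q (numer a))].

Lemma level_near_fracs Q k : level k (near_fracs Q k).
Proof. by move=> x y xy [p pQ xp]; exists p => //; rewrite -xy. Qed.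

Lemma near_fracs_le Q k k' : (k <= k')%N -> near_fracs Q k' `<=` near_fracs Q k.
Proof. by move=> kk' x [p pQ /(Tr_le kk') xp]; exists p. Qed.

Lemma numerators_numer Q p : Q != 0 -> numerators Q p ->
  exists2 a, p = numer a & @primitive F d Q a.
Proof.
move=> Q0 pQ; have [a pa] : exists a, p = @numer F d (size Q).-1 a.
  apply: numer_ex => i; have [/(_ i) pi _] := pQ.
  by rewrite -ltnS (leq_trans pi)// leqSpred.
by exists a => //; apply/asboolP; rewrite -pa.
Qed.

Lemma near_fracsE Q k : Q != 0 ->
  near_fracs Q k = \bigcup_(a in [set` @primitive F d Q]) frac_cell k a.
Proof.
move=> Q0; apply/seteqP; split=> [x [p /(numerators_numer Q0)[a -> pa] xp]|].
  by exists a.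
by move=> x [a /asboolP pa xa]; exists (numer a).
Qed.

Lemma trivIset_frac_cell Q k : Q \is monic -> ((size Q).-1 <= k)%N ->
  trivIset setT (@frac_cell Q k).
Proof.
move=> Qm Qk; apply/trivIsetP => a b _ _ ab; apply/seteqP; split=> // x [/= xa xb].
move: ab => /eqP; apply; have sz (c : {ffun 'I_d -> 'rV[F]_(size Q).-1}) i :
    (size (tnth (numer c) i) < size Q)%N.
  by rewrite (leq_ltn_trans (size_numer c i))// ltn_predL size_poly_gt0 monic_neq0.
have := fracs_inj Qm Qk (sz a) (sz b) (etrans (esym xa) xb) => ab.
apply/ffunP => i; apply: (can_inj rVpolyK).
by rewrite -!tnth_numer ab.
Qed.

Lemma pr_frac_cells Q k (D : {pred {ffun 'I_d -> 'rV[F]_(size Q).-1}}) :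
  Q \is monic -> ((size Q).-1 <= k)%N ->
  pr (\bigcup_(a in [set` D]) frac_cell k a) = #|D|%:R * wt k.
Proof.
move=> Qm Qk; rewrite pr_fintype; last 2 first.
- by move=> a; exact: meas_Tr.
- exact: trivIset_frac_cell.
under eq_bigr do rewrite (pr_cell P_cell).
by rewrite sumr_const mulr_natl.
Qed.

Lemma wtD k l : wt (k + l) = wt k * wt l.
Proof. by rewrite /wt exprD invfM exprMn. Qed.

Lemma wt_gt0 l : 0 < wt l.
Proof. by rewrite exprn_gt0// invr_gt0 exprn_gt0// q_gt0. Qed.

Lemma wtK l : ((#|F| ^ l) ^ d)%:R * wt l = 1.
Proof. by rewrite !natrX -exprMn mulfV ?expr1n// expf_neq0// gt_eqF// q_gt0. Qed.

Lemma wt_le1 l : wt l <= 1.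
Proof. by rewrite exprn_ile1// ?qn_le1// ltW// qn_gt0. Qed.

Lemma wt_le l l' : (l <= l')%N -> wt l' <= wt l.
Proof. by move=> ll'; rewrite -(subnKC ll') wtD ler_piMr ?wt_le1// ltW// wt_gt0. Qed.

Lemma wt2 : wt 2 <= 1 / 16.
Proof.
have q2 : 2 <= q by rewrite ler_nat card_finNzRing_gt1.
have q4 : q ^- 2 <= 1 / 4.
  by rewrite div1r lef_pV2 ?posrE ?exprn_gt0 ?q_gt0//; nra.
have q0 := qn_gt0 R F 2.
apply: (@le_trans _ _ ((q ^- 2) ^+ 2)); last by rewrite [leLHS]expr2; nra.
by rewrite /wt ler_wiXn2l// ?ltW ?qn_le1//; lra.
Qed.

Lemma pr_near_fracs_ge Q l : Q \is monic ->
  wt l / 4 <= pr (near_fracs Q ((size Q).-1 + l)).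
Proof.
move=> Qm; have Q0 := monic_neq0 Qm.
rewrite near_fracsE// pr_frac_cells ?leq_addr// wtD mulrA.
have := card_primitive R d_ge2 Q0; set m := (size Q).-1.
move=> /(ler_wpM2r (ltW (wt_gt0 m))) /(ler_wpM2r (ltW (wt_gt0 l))).
by apply: le_trans; rewrite [X in _ <= X * _]mulrAC wtK; lra.
Qed.

Lemma pr_near_fracs_le Q l : Q \is monic ->
  pr (near_fracs Q ((size Q).-1 + l)) <= wt l.
Proof.
move=> Qm; have Q0 := monic_neq0 Qm.
rewrite near_fracsE// pr_frac_cells ?leq_addr// wtD mulrA.
rewrite -[leRHS]mul1r ler_wpM2r ?(ltW (wt_gt0 _))//.
rewrite -[leRHS](wtK (size Q).-1) ler_wpM2r ?(ltW (wt_gt0 _))// ler_nat.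
apply: leq_trans (max_card _) _.
by rewrite card_ffun card_mx mul1n card_ord.
Qed.

Lemma pr_near_fracsI Q Q' l l' : Q \is monic -> Q' \is monic -> Q != Q' ->
  pr (near_fracs Q ((size Q).-1 + l) `&` near_fracs Q' ((size Q').-1 + l'))
    <= wt l * wt l'.
Proof.
wlog : Q Q' l l' / ((size Q).-1 + l <= (size Q').-1 + l')%N => [h|kk'] Qm Qm' QQ'.
  have [kk'|/ltnW kk'] := leqP ((size Q).-1 + l) ((size Q').-1 + l'); first exact: h.
  by rewrite setIC mulrC; apply: h; rewrite // eq_sym.
have Q0 := monic_neq0 Qm; have Q0' := monic_neq0 Qm'.
have := @card_close_fractions F d Q Q' l Qm Qm' QQ'.
set S := [pred a' | _] => cS.
apply: (@le_trans _ _ (pr (\bigcup_(a in [set` S]) frac_cell ((size Q').-1 + l') a))).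
  apply: pr_le.
  - by apply: measurableI; apply: meas_level; exact: level_near_fracs.
  - by apply: fin_bigcup_measurable => [|a _]; [exact: finite_finset|exact: meas_Tr].
  move=> x [[p /(numerators_numer Q0)[a -> pa] xp]].
  move=> [p' /(numerators_numer Q0')[a' -> pa'] xp'].
  exists a' => //; apply/andP; split=> //; apply/existsP; exists a; rewrite pa /=.
  by apply/eqP; rewrite -xp; exact: Tr_le kk' xp'.
rewrite pr_frac_cells ?leq_addr// wtD mulrA ler_wpM2r ?(ltW (wt_gt0 _))//.
rewrite -(ler_pM2r (_ : 0 < ((#|F| ^ (size Q').-1) ^ d)%:R * ((#|F| ^ l) ^ d)%:R)); last first.
  by rewrite -natrM ltr0n muln_gt0 !expn_gt0 (ltnW (card_finNzRing_gt1 F)).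
rewrite [leLHS](_ : _ = (((#|F| ^ (size Q').-1) ^ d)%:R * wt (size Q').-1) *
  (#|S|%:R * ((#|F| ^ l) ^ d)%:R)); last by ring.
rewrite [leRHS](_ : _ = (((#|F| ^ l) ^ d)%:R * wt l) * ((#|F| ^ (size Q').-1) ^ d)%:R).
  by rewrite !wtK !mul1r -natrM ler_nat.
by ring.
Qed.

End Events.

Lemma pick_partial_sum (R : realType) (I : eqType) (w : I -> R) (s : seq I) :
  uniq s -> (forall i, w i <= 1 / 8) -> 1 / 8 <= \sum_(i <- s) w i ->
  exists s', [/\ uniq s', {subset s' <= s} & 1 / 8 <= \sum_(i <- s') w i <= 1 / 4].
Proof.
move=> us w8; elim: s us => [|i s IH] /=; first by rewrite big_nil; lra.
move=> /andP[iNs us] ws; have [s8|s8] := leP (1 / 8) (\sum_(i <- s) w i).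
  have [s' [us' ss' ws']] := IH us s8; exists s'; split=> // j /ss' js.
  by rewrite inE js orbT.
exists (i :: s); split=> //=; first by rewrite iNs.
by rewrite ws /= big_cons; have := w8 i; lra.
Qed.

Section Limsup.
Variables (R : realType) (F : finFieldType) (d : nat).
Variable P : probability (cylType F d) R.
Local Notation T := (d.-tuple (laurent F)).
Local Notation q := (#|F|%:R : R).
Hypothesis P_cell : forall N a, P (@Tr F d N @^-1` [set a]) = ((q ^- N) ^+ d)%:E.
Hypothesis d_ge2 : (2 <= d)%N.
Local Notation meas := (@measurable _ (cylType F d)).
Local Notation pr := (prob P).
Local Notation wt := (wt R F d).
Implicit Types (Q : {poly F}) (A B : set T).

Lemma pr_UI A B : meas A -> meas B -> pr (A `|` B) = pr A + pr B - pr (A `&` B).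
Proof.
move=> mA mB; have := pr_DI P (measurableU _ _ mA mB) mA.
rewrite setDUl setDv set0U (setIidr (@subsetUl _ A B)).
by have := pr_DI P mB mA; rewrite [B `&` A]setIC; lra.
Qed.

Lemma set_cons_bigcup (I : choiceType) (E : I -> set T) i s :
  \bigcup_(j in [set` i :: s]) E j = E i `|` \bigcup_(j in [set` s]) E j.
Proof.
apply/seteqP; split=> x.
  by move=> [j]; rewrite /= inE => /orP[/eqP ->|js] Ej; [left|right; exists j].
by move=> [Ei|[j js Ej]]; [exists i|exists j] => //=; rewrite inE ?eqxx// js orbT.
Qed.

Lemma meas_bigcup_seq (I : choiceType) (E : I -> set T) (s : seq I) :
  (forall i, meas (E i)) -> meas (\bigcup_(j in [set` s]) E j).
Proof.
move=> mE; elim: s => [|i s IH]; last first.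
  by rewrite set_cons_bigcup; exact: measurableU.
by rewrite set_nil bigcup_set0.
Qed.

Lemma pr_I_bigcup (I : choiceType) (E : I -> set T) (s : seq I) A :
  (forall i, meas (E i)) -> meas A ->
  pr (A `&` \bigcup_(j in [set` s]) E j) <= \sum_(j <- s) pr (A `&` E j).
Proof.
move=> mE mA; elim: s => [|i s IH].
  by rewrite set_nil bigcup_set0 setI0 (pr0 P) big_nil.
rewrite set_cons_bigcup setIUr big_cons; apply: le_trans (pr_U _ _ _) _.
- exact: measurableI.
- by apply: measurableI => //; exact: meas_bigcup_seq.
- by rewrite lerD2l.
Qed.

Lemma bonferroni (I : choiceType) (E : I -> set T) (w : I -> R) (s : seq I) :
  (forall i, meas (E i)) -> uniq s -> (forall i, 0 <= w i) ->
  (forall i, i \in s -> w i / 4 <= pr (E i)) ->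
  (forall i j, i \in s -> j \in s -> i != j -> pr (E i `&` E j) <= w i * w j) ->
  (\sum_(i <- s) w i) / 4 - (\sum_(i <- s) w i) ^+ 2 / 2 <=
    pr (\bigcup_(j in [set` s]) E j).
Proof.
move=> mE + w0; elim: s => [|i s IH] /=.
  by rewrite set_nil bigcup_set0 (pr0 P) big_nil; lra.
move=> /andP[iNs us] Ew EE; rewrite set_cons_bigcup big_cons.
rewrite pr_UI//; last exact: meas_bigcup_seq.
have si j : j \in s -> j \in i :: s by rewrite inE => ->; rewrite orbT.
have ii : i \in i :: s by rewrite inE eqxx.
have h1 := IH us (fun j js => Ew j (si j js))
  (fun j k js ks => EE j k (si j js) (si k ks)).
have h2 : pr (E i `&` \bigcup_(j in [set` s]) E j) <= w i * \sum_(j <- s) w j.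
  apply: le_trans (pr_I_bigcup _ _ _) _ => //.
  rewrite mulr_sumr big_seq [leRHS]big_seq; apply: ler_sum => j js.
  by apply: EE => //; [exact: si|apply: contraNneq iNs => ->].
have h3 := Ew _ ii; have := sqr_ge0 (w i).
move: h1 h2; set S := \sum_(j <- s) w j.
rewrite sqrrD; lra.
Qed.

Variables (G : set {poly F}) (l : {poly F} -> nat).
Hypothesis G_monic : forall Q, G Q -> Q \is monic.
Hypothesis G_sum : (\esum_(Q in G) (wt (l Q))%:E = +oo)%E.

Definition tail_union v n : set T :=
  \bigcup_(Q in G `&` [set Q | (n <= (size Q).-1)%N])
    @near_fracs F d Q ((size Q).-1 + (l Q + v)).

Definition core : set T := \bigcap_m tail_union m.+2 m.

Lemma meas_near_fracs Q k : meas (@near_fracs F d Q k).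
Proof. by apply: meas_level; exact: level_near_fracs. Qed.

Lemma meas_tail_union v n : meas (tail_union v n).
Proof.
rewrite /tail_union bigcup_mkcond.
apply: countable_bigcupT_measurable => [|Q]; first exact: countableP.
by case: ifP => _; [exact: meas_near_fracs|exact: measurable0].
Qed.

Lemma meas_core : meas core.
Proof. by apply: bigcap_measurableType => m _; exact: meas_tail_union. Qed.

Lemma tail_union_le v v' n n' : (v <= v')%N -> (n <= n')%N ->
  tail_union v' n' `<=` tail_union v n.
Proof.
move=> vv' nn' x [Q [GQ /= nQ] xQ]; exists Q; first by split=> //=; exact: leq_trans nQ.
by apply: near_fracs_le xQ; rewrite !leq_add2l.
Qed.

Lemma esum_tail n :
  (\esum_(Q in G `&` [set Q | (n <= (size Q).-1)%N]) (wt (l Q))%:E = +oo)%E.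
Proof.
have w0 Q : (0%:E <= (wt (l Q))%:E)%E by rewrite lee_fin ltW// wt_gt0.
have := @esumID R {poly F} [set Q | (n <= (size Q).-1)%N] G
  (fun Q => (wt (l Q))%:E) (fun Q _ => w0 Q); rewrite G_sum => /esym.
set S := esum _ _; set S' := esum _ _ => SS'.
have fin : finite_set (G `&` ~` [set Q | (n <= (size Q).-1)%N]).
  apply: (@sub_finite_set _ _ (range (@rVpoly F n.+1))); last first.
    by apply: finite_image; exact: finite_finset.
  move=> Q [_ /negP]; rewrite -ltnNge => nQ; exists (poly_rV Q) => //.
  by rewrite poly_rV_K// (leq_trans (leqSpred _))// ltnW.
have : (S' < +oo)%E.
  rewrite /S' esum_fset; [|exact: fin|by move=> Q _; exact: w0].
  by rewrite fsbig_finite//= sumEFin ltry.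
by case: S' SS' => [r| |]//; case: S.
Qed.

Lemma pr_tail_union v n : (2 <= v)%N -> 3 / 128 <= pr (tail_union v n).
Proof.
move=> v2; pose w Q := wt (l Q + v).
have wv k : wt (k + v) = wt k * wt v by exact: wtD.
have : ((1 / 8 / wt v)%:E <
    \esum_(Q in G `&` [set Q | (n <= (size Q).-1)%N]) (wt (l Q))%:E)%E.
  by rewrite esum_tail ltry.
move=> /ereal_sup_gt[_ [X [finX XG] <-]].
rewrite fsbig_finite//= sumEFin lte_fin => wX.
have [| | |s [us sX /andP[s8 s4]]] := @pick_partial_sum R _ w (finmap.enum_fset (fset_set X)).
- exact: finmap.fset_uniq.
- move=> Q; apply: le_trans (wt_le R F d (_ : 2 <= l Q + v)%N) _; first by lia.
  by have := wt2 R F d_ge2; lra.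
- have -> : \sum_(i <- finmap.enum_fset (fset_set X)) w i =
      (\sum_(i <- finmap.enum_fset (fset_set X)) wt (l i)) * wt v.
    by rewrite mulr_suml; apply: eq_bigr => Q _; exact: wv.
  by rewrite -ler_pdivrMr ?wt_gt0// ltW.
have sG Q : Q \in s -> G Q /\ (n <= (size Q).-1)%N.
  by move=> /sX; rewrite in_fset_set// inE => /XG.
pose E Q := @near_fracs F d Q ((size Q).-1 + (l Q + v)).
have := @bonferroni _ E w s (fun Q => meas_near_fracs _ _) us.
move=> /(_ (fun Q => ltW (wt_gt0 R F d _))) h.
apply: (@le_trans _ _ (pr (\bigcup_(Q in [set` s]) E Q))); last first.
  apply: pr_le; [by apply: meas_bigcup_seq => Q; exact: meas_near_fracs|exact: meas_tail_union|].
  by move=> x [Q Qs xQ]; exists Q => //; exact: sG.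
apply: le_trans (h _ _).
- by move: s8 s4; set S := \sum_(i <- s) w i => s8 s4; nra.
- by move=> Q /sG[/G_monic Qm _]; exact: pr_near_fracs_ge.
- by move=> Q Q' /sG[/G_monic Qm _] /sG[/G_monic Qm' _]; exact: pr_near_fracsI.
Qed.

Lemma pr_core : 3 / 128 <= pr core.
Proof.
have nd : nonincreasing_seq (fun m => tail_union m.+2 m).
  by move=> m n mn; apply/subsetPset; apply: tail_union_le => //; rewrite !ltnS.
have c : P (tail_union m.+2 m) @[m --> \oo] --> P core.
  apply: nonincreasing_cvg_mu => //.
  - exact: (le_lt_trans (probability_le1 P (meas_tail_union _ _)) (ltry 1)).
  - by move=> m; exact: meas_tail_union.
  - exact: meas_core.
rewrite -lee_fin -prE; last exact: meas_core.
apply: (cvge_to_ge c); apply: nearW => m; rewrite (prE P); last exact: meas_tail_union.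
by rewrite lee_fin; exact: pr_tail_union.
Qed.

(* The shear acts on numerators by a matrix of determinant 1, so it maps
   reduced fractions to reduced fractions of the same denominator. *)
Lemma shear_near_fracs (i j : 'I_d) N Q k x : i != j -> Q != 0 ->
  @near_fracs F d Q (k + N) x -> @near_fracs F d Q k (shear i j N x).
Proof.
move=> ij Q0 [p /(numeratorsP _ Q0)[sp cp] xp].
pose pi := tnth p i + 'X^N * tnth p j.
exists [tuple if l == i then pi %% Q else tnth p l | l < d].
  apply/(numeratorsP _ Q0); split=> [m|g gp gQ].
    by rewrite tnth_mktuple; case: ifP => // _; rewrite ltn_modp.
  apply: cp => // m.
  have gm m' : m' != i -> g %| tnth p m'.
    by move=> mi; have := gp m'; rewrite tnth_mktuple (negbTE mi).
  have [->|/gm//] := eqVneq m i.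
  have := gp i; rewrite tnth_mktuple eqxx -[X in g %| X](addrK (pi %/ Q * Q)).
  rewrite [X in X - _]addrC -divp_eq dvdp_subl ?dvdp_mull//.
  by rewrite dvdp_addl// dvdp_mull// gm// eq_sym.
rewrite (Tr_shear i j xp); apply/TrP => m; rewrite tnth_shear !tnth_mktuple.
case: ifP => // _.
have -> : (tnth p i)%:L / Q%:L + ('X^N)%:L * ((tnth p j)%:L / Q%:L) =
    (pi %/ Q)%:L + (pi %% Q)%:L / Q%:L.
  rewrite mulrA -polyLM -mulrDl -polyLD -/pi {1}(divp_eq pi Q) polyLD polyLM mulrDl.
  by rewrite mulfK// polyL_eq0.
by rewrite trD tr_polyL add0r.
Qed.

Lemma core_shear i j N : i != j -> core `<=` shear i j N @^-1` core.
Proof.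
move=> ij x xc m _; have [Q [GQ /= mQ] xQ] := xc (m + N)%N Logic.I.
exists Q; first by split=> //=; rewrite (leq_trans _ mQ)// leq_addr.
apply: (@shear_near_fracs i j N Q) => //; first exact/monic_neq0/G_monic.
by apply: near_fracs_le xQ; rewrite -!addnA !leq_add2l.
Qed.

Lemma pr_core1 : pr core = 1.
Proof.
have := zero_one P_cell d_ge2 meas_core core_shear.
by case=> // c0; have := pr_core; rewrite c0; lra.
Qed.

End Limsup.

Section AbsoluteValueBalls.
Variables (R : realType) (F : finFieldType).
Local Notation q := (#|F|%:R : R).

Lemma labs_lead (f : laurent F) (N : int) : bnd f N -> f N != 0 -> labs R f = q ^ N.
Proof. by move=> fN fN0; rewrite /labs (ldeg_lead fN fN0). Qed.

Lemma labs_ge0 (f : laurent F) : 0 <= labs R f.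
Proof. by rewrite /labs; case: (ldeg f) => // n; rewrite exprz_ge0// ler0n. Qed.

Lemma labs_gt0 (f : laurent F) : f != 0 -> 0 < labs R f.
Proof.
move=> /laurent_lead[N fN fN0]; rewrite (labs_lead fN fN0) exprz_gt0//.
by rewrite ltr0n (ltnW (card_finNzRing_gt1 F)).
Qed.

Lemma labs_lt_bnd (r : R) : 0 < r ->
  exists k : nat, forall f : laurent F, bnd f (-1) ->
    (labs R f < r <-> bnd f (- k.+1%:Z)).
Proof.
move=> r0; have q1 : 1 < q by rewrite ltr1n card_finNzRing_gt1.
have q0 : 0 < q by lra.
have [k kr kmin] : exists2 k : nat, q ^- k.+1 < r &
    forall j : nat, q ^- j.+1 < r -> (k <= j)%N.
  have ex : exists k : nat, q ^- k.+1 < r.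
    exists (Num.bound r^-1); rewrite invf_plt ?posrE ?exprn_gt0//.
    apply: lt_trans (archi_boundP _) _; first by rewrite invr_ge0 ltW.
    rewrite -natrX ltr_nat; apply: ltn_trans (ltn_expl _ (card_finNzRing_gt1 F)) _.
    by rewrite ltn_exp2l ?card_finNzRing_gt1.
  by have [k kr kmin] := ex_minnP ex; exists k.
exists k => f f1; have [->|f0] := eqVneq f 0.
  by rewrite /labs ldeg0; split.
have [N fN fN0] := laurent_lead f0; rewrite (labs_lead fN fN0).
have N1 : N <= -1 by rewrite leNgt; apply: contra fN0 => /f1 ->.
have [j Nj] : exists j : nat, N = - j.+1%:Z by exists (absz (N + 1)%R); lia.
rewrite Nj in fN fN0 *; rewrite -exprnN; split=> [/kmin kj|fk].
  by apply: bnd_le fN _; lia.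
have kj : (k <= j)%N.
  by rewrite leqNgt; apply: contra fN0 => jk; rewrite fk//; lia.
apply: le_lt_trans kr; rewrite lef_pV2 ?posrE ?exprn_gt0//.
by rewrite ler_eXn2l.
Qed.

Lemma HQ_near_fracs d (Psi : {poly F} -> R) (Q : {poly F}) : Q \is monic -> 0 < Psi Q ->
  exists k, HQ d Psi Q = near_fracs Q k `&` @unit_cube F d.
Proof.
move=> Qm Psi0.
have [k kP] : exists k : nat, forall f : laurent F, bnd f (-1) ->
    (labs R f < Psi Q / labs R Q%:L <-> bnd f (- k.+1%:Z)).
  by apply: labs_lt_bnd; rewrite divr_gt0// labs_gt0// polyL_monic_neq0.
exists k; have ball (x : laurent F) (p : {poly F}) : lfrac_part F x -> (size p < size Q)%N ->
    lball (p%:L / Q%:L) (Psi Q / labs R Q%:L) x <-> tr k x = tr k (p%:L / Q%:L).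
  move=> /lfrac_partP x1 pQ; have p1 := bnd_frac Qm pQ.
  by rewrite (tr_bnd k x1 p1); apply: kP; exact: bndB.
apply/seteqP; split=> x.
  move=> [xU [p pQ xp]]; split=> //; exists p => //; apply/TrP => i.
  by rewrite tnth_mktuple; apply/(ball _ _ (xU i)); [case: pQ|exact: xp].
move=> [[p pQ /TrP xp] xU]; split=> //; exists p => // i.
apply/(ball _ _ (xU i)); first by case: pQ.
by have := xp i; rewrite tnth_mktuple.
Qed.

Lemma HQ_eq0 d (Psi : {poly F} -> R) (Q : {poly F}) : (0 < d)%N -> Psi Q <= 0 ->
  HQ d Psi Q = set0.
Proof.
move=> d0 Psi0; apply/seteqP; split=> // x [_ [p _ /(_ (Ordinal d0))]].
rewrite /lball /= ltNge; apply/negP; rewrite negbK.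
by apply: le_trans (labs_ge0 _); rewrite mulr_le0_ge0// invr_ge0 labs_ge0.
Qed.

End AbsoluteValueBalls.

Section Limsups.
Variables (R : realType) (F : finFieldType) (d : nat).
Variable P : probability (cylType F d) R.
Local Notation meas := (@measurable _ (cylType F d)).
Variables (G : set {poly F}) (k : {poly F} -> nat).

Definition limsup_near_fracs : set (d.-tuple (laurent F)) :=
  \bigcap_(n in [set n | (1 <= n)%N])
    \bigcup_(Q in G `&` [set Q | (n <= (size Q).-1)%N]) near_fracs Q (k Q).

Lemma meas_limsup_near_fracs : meas limsup_near_fracs.
Proof.
apply: bigcap_measurableType => n _; rewrite bigcup_mkcond.
apply: countable_bigcupT_measurable => [|Q]; first exact: countableP.
by case: ifP => _; [exact: meas_near_fracs|exact: measurable0].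
Qed.

Lemma limsup_near_fracs0 :
  (\esum_(Q in G) P (near_fracs Q (k Q)) < +oo)%E -> P limsup_near_fracs = 0%E.
Proof.
move=> finG; pose N Q := if Q \in G then @near_fracs F d Q (k Q) else set0.
pose E (j : nat) := if pickle_inv j is Some Q then N Q else set0.
have mN Q : meas (N Q).
  by rewrite /N; case: ifP => _; [exact: meas_near_fracs|exact: measurable0].
have mE j : meas (E j) by rewrite /E; case: pickle_inv.
have E0 : P (lim_sup_set E) = 0%E.
  apply: lim_sup_set_cvg0 => //; rewrite nneseries_esumT//.
  rewrite (_ : esum _ _ = \esum_(j in range (@pickle {poly F})) P (E j)); last first.
    rewrite [RHS]esum_mkcond; apply: eq_esum => j _; case: ifPn => // jr.
    rewrite /E; case e : (pickle_inv j) => [Q|]; last by rewrite measure0.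
    exfalso; move/negP: jr; apply; rewrite inE; exists Q => //.
    by have := @pickle_invK {poly F} j; rewrite e.
  rewrite (reindex_esum [set: {poly F}] (range (@pickle {poly F})) (@pickle {poly F})); last first.
    by apply: inj_bij => Q Q' _ _; exact: (pcan_inj pickleK).
  apply: le_lt_trans finG; rewrite [leRHS]esum_mkcond.
  apply: le_esum => Q _; rewrite /E pickleK_inv /N.
  by case: ifP => _ //; rewrite measure0.
apply/eqP; rewrite eq_le measure_ge0 andbT -E0.
apply: le_measure; rewrite ?inE.
- exact: meas_limsup_near_fracs.
- by apply: bigcap_measurableType => n _; exact: bigcup_measurable.
move=> x xL n _.
pose M := (\max_(j < n) (if pickle_inv j is Some Q then size (Q : {poly F}) else 0))%N.
have [Q [GQ /= MQ] xQ] := xL M.+1 isT.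
exists (pickle Q) => /=; last by rewrite /E pickleK_inv /N mem_set.
rewrite leqNgt; apply/negP => Qn.
have := leq_bigmax (F := fun j : 'I_n => if pickle_inv j is Some Q
  then size (Q : {poly F}) else 0%N) (Ordinal Qn).
rewrite /= pickleK_inv -/M leqNgt => /negP; apply.
by apply: leq_trans MQ _; exact: leq_pred.
Qed.

End Limsups.

Theorem theorem1p14 (R : realType) (F : finFieldType)
    (nu : {measure set (laurent F) -> \bar R})
    (haar_nu : haar_measure nu) (nu_L : nu (lfrac_part F) = 1%E)
    (d : nat) (hd : (2 <= d)%N)
    (Psi : {poly F} -> R) (Psi_ge0 : forall Q, 0 <= Psi Q) :
  power_measure nu d (Hlimsup d Psi) = 1%E <->
  (\esum_(Q in [set Q : {poly F} | Q \is monic])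
     power_measure nu d (HQ d Psi Q) = +oo)%E.
Proof.
have [P [P_cell PE]] := torus_measure_ex haar_nu nu_L d.
pose G := [set Q : {poly F} | Q \is monic] `&` [set Q | 0 < Psi Q].
have /choice[k kP] : forall Q, exists k,
    G Q -> HQ d Psi Q = near_fracs Q k `&` @unit_cube F d.
  move=> Q; have [[Qm Psi0]|nG] := pselect (G Q); last by exists 0%N => /nG.
  by have [n nP] := HQ_near_fracs d Qm Psi0; exists n.
have HQ0 Q : ~ 0 < Psi Q -> HQ d Psi Q = set0.
  by move=> /negP; rewrite -leNgt => Psi0; apply: HQ_eq0 => //; exact: ltnW.
have sumE : (\esum_(Q in [set Q : {poly F} | Q \is monic])
    power_measure nu d (HQ d Psi Q) = \esum_(Q in G) P (near_fracs Q (k Q)))%E.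
  rewrite [RHS]esum_mkcondr; apply: eq_esum => Q Qm; case: ifPn => [|Psi0].
    by rewrite inE => Psi0; rewrite kP// PE.
  by rewrite HQ0 ?PE; [|by move=> ?; move/negP: Psi0; apply; rewrite inE];
    rewrite -[set0](set0I (@unit_cube F d)) -PE measure0.
have limE : power_measure nu d (Hlimsup d Psi) = P (@limsup_near_fracs F d G k).
  rewrite PE; congr (power_measure _ _ _); apply/seteqP; split=> x.
    move=> xH; split=> [n n1|]; last by have [Q _ []] := xH 1%N isT.
    have [Q [Qm nQ] xQ] := xH n n1.
    have GQ : G Q by split=> //; apply: contrapT => /HQ0 H0; rewrite H0 in xQ.
    by exists Q => //; move: xQ; rewrite kP// => -[].
  move=> [xL xU] n n1; have [Q [GQ nQ] xQ] := xL n n1.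
  by exists Q; [split => //; case: GQ|rewrite kP].
rewrite sumE limE; split=> [lim1|sumoo].
  apply/eqP; rewrite -leye_eq leNgt; apply/negP => /limsup_near_fracs0 lim0.
  by move: lim1; rewrite lim0 => /eqP; rewrite eq_sym onee_eq0.
pose l Q := (k Q - (size Q).-1)%N.
have lsum : (\esum_(Q in G) (wt R F d (l Q))%:E = +oo)%E.
  apply/eqP; rewrite -leye_eq -sumoo; apply: le_esum => Q [Qm _].
  rewrite (prE P) ?lee_fin; last exact: meas_near_fracs.
  have [dk|/ltnW kd] := leqP (size Q).-1 (k Q).
    by have := pr_near_fracs_le P_cell (l Q) Qm; rewrite subnKC.
  rewrite /l (eqP kd) /wt invr1 expr1n; apply: pr_le1; exact: meas_near_fracs.
have G_monic Q : G Q -> Q \is monic by case.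
have core1 := pr_core1 P_cell hd G_monic lsum.
apply/eqP; rewrite eq_le probability_le1 /=; last exact: meas_limsup_near_fracs.
rewrite -core1 -prE; last exact: meas_core.
apply: le_measure; rewrite ?inE; [exact: meas_core|exact: meas_limsup_near_fracs|].
move=> x xc n n1; have [Q [GQ nQ] xQ] := xc n Logic.I; exists Q => //.
by apply: near_fracs_le xQ; rewrite addnA (leq_trans _ (leq_addr _ _))// -leq_subLR.
Qed.
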